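(* Let $G_k$ be the iteration matrix, real ($\mathbb{F}=\mathbb{R}$) or complex ($\mathbb{F}=\mathbb{C}$), at the start of step $k\ge1$ of the one-sided Jacobi SVD method, and assume that $G_k=\mathrm{fl}(G_k)$, i.e., its elements (their components) are exactly floating-point numbers. Let $\varsigma^{\mathbb{R}}=2$ and $\varsigma^{\mathbb{C}}=4$. If $\|G_k\|_{\max}\le\nu/\varsigma^{\mathbb{F}}$, then the matrix $\mathrm{fl}(G_{k+1})$ computed from $G_k$ by the Jacobi transformations of step $k$ satisfies $\|\mathrm{fl}(G_{k+1})\|_{\max}\le\nu$.
   Context: **Floating-point conventions.** Floating-point numbers are those of a standard IEEE 754 binary format (with subnormal numbers) with $p$ explicitly stored significand bits, $p\ge23$ ($p=23,52,112$ for single, double, quadruple precision); rounding is to nearest, ties to even, and exceptions do not trap. $\mathrm{fl}$ of a single real operation is its correctly rounded result; $\mathrm{fl}$ of the product of a complex and a real number is taken componentwise. $\nu$ is the largest finite and $\check\mu$ the smallest positive (subnormal) floating-point number. For real arguments $\mathrm{fma}(a,b,c)=\mathrm{fl}(a\cdot b+c)$ with a single rounding. For complex arguments, $\tilde d=\mathrm{fma}(a,b,c)$ is defined by $$\Re\tilde d=\mathrm{fma}(\Re a,\Re b,\mathrm{fma}(-\Im a,\Im b,\Re c)),\qquad \Im\tilde d=\mathrm{fma}(\Re a,\Im b,\mathrm{fma}(\Im a,\Re b,\Im c)).$$ $\mathrm{fmin}$ and $\mathrm{fmax}$ return their second argument if the first one is NaN; $\mathrm{sign}(\pm0)=\pm1$.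 $\|G\|_{\max}=\max_{i,j}|g_{ij}|$. **The step.** In step $k$ a set of pairwise disjoint pivot column pairs $(p,q)$, $p<q$, of $G_k$ is chosen; each column belongs to at most one pair. For each pair, the columns are either left unchanged or transformed by a computed Jacobi rotation, and (in either case) possibly swapped; columns in no pair are unchanged. The transformation replaces, for every row $i$, the elements $g_{ip},g_{iq}$ by $$\mathrm{fl}(g_{ip}')=\mathrm{fl}\bigl(\mathrm{fma}(g_{iq},\mathrm{e}',g_{ip})\,\mathrm{fl}(\cos\varphi)\bigr),\qquad \mathrm{fl}(g_{iq}')=\mathrm{fl}\bigl(\mathrm{fma}(g_{ip},-\bar{\mathrm{e}}',g_{iq})\,\mathrm{fl}(\cos\varphi)\bigr),$$ with $\mathrm{e}'$ and $\mathrm{fl}(\cos\varphi)$ depending on the pair. The result of all these replacements is $\mathrm{fl}(G_{k+1})$. **The computed Jacobi rotation** of a pair comes from a Hermitian (real symmetric if $\mathbb{F}=\mathbb{R}$) matrix of order two with entries $a_{11},a_{21},a_{22}$ (and $a_{12}=\bar a_{21}$) having floating-point components, $\max|a_{ij}|\le\nu/(4\sqrt2)$. If $\mathbb{F}=\mathbb{R}$, let $h=|a_{21}|$, $\mathrm{fl}(\cos\alpha)=\mathrm{sign}\,a_{21}$, $\mathrm{fl}(\sin\alpha)=0$. If $\mathbb{F}=\mathbb{C}$, with $m=\min\{|\Re a_{21}|,|\Im a_{21}|\}$, $M=\max\{|\Re a_{21}|,|\Im a_{21}|\}$, $\tilde q=\mathrm{fmax}(\mathrm{fl}(m/M),0)$,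 let $$h=\mathrm{fl}\bigl(M\cdot\mathrm{fl}\bigl(\sqrt{\mathrm{fma}(\tilde q,\tilde q,1)}\bigr)\bigr),$$ $$\mathrm{fl}(\cos\alpha)=\mathrm{fmin}\bigl(\mathrm{fl}(|\Re a_{21}|/h),1\bigr)\cdot\mathrm{sign}\,\Re a_{21},\qquad \mathrm{fl}(\sin\alpha)=\mathrm{fl}\bigl(\Im a_{21}/\max\{h,\check\mu\}\bigr).$$ In both cases, with $\tilde a=\mathrm{fl}(a_{11}-a_{22})$, $$\tau=\min\bigl(\mathrm{fmax}(\mathrm{fl}(2h/|\tilde a|),0),\mathrm{fl}(\sqrt\nu)\bigr)\cdot\mathrm{sign}\,\tilde a,\quad \mathrm{fl}(\tan\varphi)=\mathrm{fl}\Bigl(\tau\big/\mathrm{fl}\bigl(1+\mathrm{fl}(\sqrt{\mathrm{fma}(\tau,\tau,1)})\bigr)\Bigr),$$ $$\mathrm{fl}(\cos\varphi)=\mathrm{fl}\Bigl(1\big/\mathrm{fl}\bigl(\sqrt{\mathrm{fma}(\mathrm{fl}(\tan\varphi),\mathrm{fl}(\tan\varphi),1)}\bigr)\Bigr),$$ $$\mathrm{e}'=\mathrm{fl}\bigl(\mathrm{fl}(\cos\alpha)\,\mathrm{fl}(\tan\varphi)\bigr)+\mathrm{i}\,\mathrm{fl}\bigl(\mathrm{fl}(\sin\alpha)\,\mathrm{fl}(\tan\varphi)\bigr).$$ *)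

(* Defs.v *)
From mathcomp Require Import all_boot matrix.
From Stdlib Require Import ZArith Reals SpecFloat.

Set Implicit Arguments.
Unset Strict Implicit.
Unset Printing Implicit Defensive.

(** Floating-point data are the [spec_float]s of the standard library, whose
    operations round to nearest, ties to even.  A format is given by the number
    [p] of explicitly stored significand bits and the width [w] of the exponent
    field; (23, 8), (52, 11) and (112, 15) are binary32, binary64, binary128.
    [spec_float] counts the implicit bit in [prec], and its [emax] is one more
    than the largest exponent of IEEE 754 (finite numbers are below 2^emax). *)
Section Format.
Context (p w : Z).

Definition fprec : Z := (p + 1)%Z.
Definition femax : Z := (2 ^ (w - 1))%Z.

Definition fadd := SFadd fprec femax.
Definition fsub := SFsub fprec femax.
Definition fmul := SFmul fprec femax.
Definition fdiv := SFdiv fprec femax.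
Definition fsqrt := SFsqrt fprec femax.

Definition f0 := S754_zero false.
Definition f1 := SFone fprec femax.
Definition f2 := fadd f1 f1.
Definition fnu := SFmax_float fprec femax.
Definition fmu := S754_finite false 1 (emin fprec femax).

(* The product x * y, unrounded: a finite result need not be representable. *)
Definition mul_exact (x y : spec_float) : spec_float :=
  match x, y with
  | S754_nan, _ | _, S754_nan => S754_nan
  | S754_infinity _, S754_zero _ | S754_zero _, S754_infinity _ => S754_nan
  | S754_infinity sx, (S754_infinity sy | S754_finite sy _ _)
  | S754_finite sx _ _, S754_infinity sy => S754_infinity (xorb sx sy)
  | S754_zero sx, (S754_zero sy | S754_finite sy _ _)
  | S754_finite sx _ _, S754_zero sy => S754_zero (xorb sx sy)
  | S754_finite sx mx ex, S754_finite sy my ey =>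
      S754_finite (xorb sx sy) (mx * my) (ex + ey)
  end.

(* [SFadd] adds arbitrary finite operands exactly before rounding, except that
   it returns an operand as it is when the other one is zero; hence the first
   case. *)
Definition fma (x y z : spec_float) : spec_float :=
  match mul_exact x y, z with
  | S754_finite s m e, S754_zero _ =>
      binary_round fprec femax s m e
  | xy, _ => fadd xy z
  end.

Definition is_nan (x : spec_float) : bool :=
  if x is S754_nan then true else false.

Definition is_finite (x : spec_float) : bool :=
  match x with S754_zero _ | S754_finite _ _ _ => true | _ => false end.

Definition is_float (x : spec_float) : bool :=
  valid_binary fprec femax x && is_finite x.

Definition sign_bit (x : spec_float) : bool :=
  match x with
  | S754_zero s | S754_infinity s | S754_finite s _ _ => s
  | S754_nan => false
  end.

(* x * sign y, with sign (+0) = 1 and sign (-0) = -1. *)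
Definition mul_sign (x y : spec_float) : spec_float :=
  if sign_bit y then SFopp x else x.

Definition min_of (x y : spec_float) := if SFltb y x then y else x.
Definition max_of (x y : spec_float) := if SFltb x y then y else x.
Definition fmin (x y : spec_float) := if is_nan x then y else min_of x y.
Definition fmax (x y : spec_float) := if is_nan x then y else max_of x y.

(* Real value; 0 is a dummy for infinities and NaN. *)
Definition value (x : spec_float) : R :=
  match x with
  | S754_finite s m e => (IZR (cond_Zopp s (Zpos m)) * powerRZ 2 e)%R
  | _ => 0%R
  end.

Definition nu : R := value fnu.

Variant scalars := RealF | ComplexF.

Definition varsigma (F : scalars) : R :=
  match F with RealF => 2%R | ComplexF => 4%R end.

(* A complex number is the pair (real part, imaginary part). *)
Definition elt (F : scalars) : Type :=
  match F with RealF => spec_float | ComplexF => (spec_float * spec_float)%type end.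

Definition elt_all (P : spec_float -> bool) (F : scalars) : elt F -> bool :=
  match F with
  | RealF => fun x => P x
  | ComplexF => fun z => P z.1 && P z.2
  end.

Definition modulus (F : scalars) : elt F -> R :=
  match F with
  | RealF => fun x => Rabs (value x)
  | ComplexF => fun z => sqrt (value z.1 ^ 2 + value z.2 ^ 2)
  end.

Definition elt_fma (F : scalars) : elt F -> elt F -> elt F -> elt F :=
  match F with
  | RealF => fma
  | ComplexF => fun a b c =>
      (fma a.1 b.1 (fma (SFopp a.2) b.2 c.1),
       fma a.1 b.2 (fma a.2 b.1 c.2))
  end.

Definition elt_scale (F : scalars) : elt F -> spec_float -> elt F :=
  match F with
  | RealF => fun x c => fmul x c
  | ComplexF => fun z c => (fmul z.1 c, fmul z.2 c)
  end.

(* - conj x *)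
Definition elt_oppconj (F : scalars) : elt F -> elt F :=
  match F with
  | RealF => SFopp
  | ComplexF => fun z => (SFopp z.1, z.2)
  end.

(* The Hermitian matrix of order two with a12 = conj a21. *)
Record herm2 (F : scalars) := Herm2
  { a11 : spec_float; a21 : elt F; a22 : spec_float }.

Definition herm2_ok (F : scalars) (A : herm2 F) : Prop :=
  [/\ is_float (a11 A), elt_all is_float (a21 A), is_float (a22 A)
    & (Rmax (Rabs (value (a11 A)))
         (Rmax (modulus (a21 A)) (Rabs (value (a22 A))))
       <= nu / (4 * sqrt 2))%R].

Definition hyp2 (z : elt ComplexF) : spec_float :=
  let m := min_of (SFabs z.1) (SFabs z.2) in
  let M := max_of (SFabs z.1) (SFabs z.2) in
  let q := fmax (fdiv m M) f0 in
  fmul M (fsqrt (fma q q f1)).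

Definition elt_abs (F : scalars) : elt F -> spec_float :=
  match F with RealF => SFabs | ComplexF => hyp2 end.

(* fl(cos alpha) + i fl(sin alpha); in the real case, where sin alpha = 0, only
   the real component is kept. *)
Definition elt_phase (F : scalars) : elt F -> elt F :=
  match F with
  | RealF => fun x => mul_sign f1 x
  | ComplexF => fun z =>
      (mul_sign (fmin (fdiv (SFabs z.1) (hyp2 z)) f1) z.1,
       fdiv z.2 (max_of (hyp2 z) fmu))
  end.

Section Rotation.
Context (F : scalars) (A : herm2 F).

(* Doubling is exact here. *)
Definition rot_tau : spec_float :=
  let a := fsub (a11 A) (a22 A) in
  mul_sign
    (min_of (fmax (fdiv (fmul f2 (elt_abs (a21 A))) (SFabs a)) f0) (fsqrt fnu)) a.

Definition rot_tan : spec_float :=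
  fdiv rot_tau (fadd f1 (fsqrt (fma rot_tau rot_tau f1))).

Definition rot_cos : spec_float :=
  fdiv f1 (fsqrt (fma rot_tan rot_tan f1)).

Definition rot_e : elt F := elt_scale (elt_phase (a21 A)) rot_tan.

(* The pair (g_ip, g_iq) becomes (g'_ip, g'_iq). *)
Definition rotate (x y : elt F) : elt F * elt F :=
  (elt_scale (elt_fma y rot_e x) rot_cos,
   elt_scale (elt_fma x (elt_oppconj rot_e) y) rot_cos).

End Rotation.

(* [rot pq = None] leaves the pair of columns pq unchanged (up to a swap). *)
Record jacobi_step (F : scalars) (n : nat) := JacobiStep
  { pivots : {set 'I_n * 'I_n};
    rot : 'I_n * 'I_n -> option (herm2 F);
    swap : 'I_n * 'I_n -> bool }.

Definition step_ok (F : scalars) (n : nat) (s : jacobi_step F n) : Prop :=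
  [/\ forall pq, pq \in pivots s -> (pq.1 < pq.2)%nat,
      forall pq rs, pq \in pivots s -> rs \in pivots s -> pq != rs ->
        [disjoint [set pq.1; pq.2] & [set rs.1; rs.2]]
    & forall pq A, pq \in pivots s -> rot s pq = Some A -> herm2_ok A].

Definition transform_pair (F : scalars) (n : nat) (s : jacobi_step F n)
    (pq : 'I_n * 'I_n) (x y : elt F) : elt F * elt F :=
  let xy := if rot s pq is Some A then rotate A x y else (x, y) in
  if swap s pq then (xy.2, xy.1) else xy.

Local Open Scope ring_scope.

(* By disjointness at most one pivot pair contains the column j. *)
Definition next_iterate (F : scalars) (m n : nat) (s : jacobi_step F n)
    (G : 'M[elt F]_(m, n)) : 'M[elt F]_(m, n) :=
  \matrix_(i, j)
    if [pick pq in pivots s | (j == pq.1) || (j == pq.2)] is Some pq then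
      let xy := transform_pair s pq (G i pq.1) (G i pq.2) in
      if j == pq.1 then xy.1 else xy.2
    else G i j.

Local Close Scope ring_scope.

Definition max_norm (F : scalars) (m n : nat) (G : 'M[elt F]_(m, n)) : R :=
  \big[Rmax/0%R]_(i < m) \big[Rmax/0%R]_(j < n) modulus (G i j).

Definition mx_all (P : spec_float -> bool) (F : scalars) (m n : nat)
    (G : 'M[elt F]_(m, n)) : Prop :=
  forall i j, elt_all P (G i j).

End Format.

(* Main.v *)
Require Import Defs.
From mathcomp Require Import all_boot matrix.
From Stdlib Require Import ZArith Reals SpecFloat Lra Lia.

(** No operation of the step overflows because every multiplier of the rotation,
    as computed, is at most one in magnitude, and because rounding to nearest is
    monotone: an exact result bounded by a representable number remains bounded
    by it after rounding ([rounds_le], [rounds_ge]).  Hence all the estimates can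
    be made on exact results, against representable bounds, without error terms.

    The multipliers are bounded as follows.  Clamping puts |tau| below the
    rounded root of nu, which is below the exact root of 2^emax by enough for
    tau^2 + 1 not to exceed nu ([sqrt_fnu], [sqr_tau_le]).  The tangent is tau
    divided by the rounded value of 1 + sqrt (tau^2 + 1).  For huge tau the
    leading 1 is lost, and so the bound |tan| <= 1 rests on the fact that the
    computed sqrt (tau^2 + 1) is never below |tau|, despite two roundings
    ([sqrt_fma_ge]).  There and for the root of nu, half an ulp
    matters.  The cosine is one divided by a root that is at least one ([rot_tan_cos]).  The components
    of the phase are at most one because the computed modulus of a complex
    number is at least its larger component ([hyp2_ge], [phase_bounded]).

    In the real case a new element is then at most nu / 2 + nu / 2 before the
    multiplication by the cosine, which cannot increase it.  In the complex case
    each component of the fused result is at most (1 + sqrt 2) / 4 of 2^emax up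
    to rounding; it is bounded by 11/16 of 2^emax ([fma2_bounded]), and as
    sqrt 2 * 11/16 < 1 - 2^-24 the modulus stays below nu
    ([elt_bounded_modulus]).

    The monotonicity of rounding is derived from the integer algorithms that
    define the operations.  A number is written as an integer part, in units of
    a power of two, and the position of its fraction relative to 0 and 1/2
    ([shr_spec]).  If the integer part has enough bits, the rounding function
    returns a nearest representable number, or an infinity exactly if that
    number exceeds nu ([binary_round_aux_spec]).  The lemmas [fadd_rounds],
    [fma_rounds], [fmul_rounds], [fdiv_rounds] and [fsqrt_rounds] follow by
    checking that each operation supplies enough bits. *)

Set Implicit Arguments.
Unset Strict Implicit.
Unset Printing Implicit Defensive.

Local Open Scope R_scope.
Local Notation pow2 := (powerRZ 2).

(** * Powers of two and bit lengths *)

Lemma pow2_gt0 e : 0 < pow2 e.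
Proof. by apply: powerRZ_lt; lra. Qed.

Lemma pow2_0 : pow2 0 = 1.
Proof. by []. Qed.

Lemma pow2_add e f : pow2 (e + f) = pow2 e * pow2 f.
Proof. by apply: powerRZ_add; lra. Qed.

Lemma pow2_opp e : pow2 (- e) = / pow2 e.
Proof. exact: powerRZ_neg'. Qed.

Lemma pow2_IZR n : (0 <= n)%Z -> IZR (2 ^ n) = pow2 n.
Proof.
case: n => [|n|n] // _.
by rewrite -Zpower_pos_powerRZ.
Qed.

Lemma pow2_sub e k : (0 <= k)%Z -> pow2 (e - k) = pow2 e / IZR (2 ^ k).
Proof. by move=> k_ge0; rewrite /Z.sub pow2_add pow2_opp pow2_IZR. Qed.

Lemma pow2_le e f : (e <= f)%Z -> pow2 e <= pow2 f.
Proof.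
move=> le_ef; have -> : f = (e + (f - e))%Z by lia.
rewrite pow2_add -(@pow2_IZR (f - e)); last lia.
have := pow2_gt0 e; have : 1 <= IZR (2 ^ (f - e)); last nra.
by apply: IZR_le; have := Z.pow_pos_nonneg 2 (f - e); lia.
Qed.

Lemma pow2_lt e f : (e < f)%Z -> pow2 e < pow2 f.
Proof.
move=> lt_ef; have : pow2 (e + 1) <= pow2 f by apply: pow2_le; lia.
by rewrite pow2_add /=; have := pow2_gt0 e; lra.
Qed.

Lemma digits2_log2 m : Zpos (digits2_pos m) = (Z.log2 (Zpos m) + 1)%Z.
Proof.
elim: m => [m IH|m IH|] //=; rewrite Pos2Z.inj_succ IH;
  case: m {IH} => //= m; lia.
Qed.

Lemma Zdigits2_bounds m : (0 < m)%Z ->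
  (2 ^ (Zdigits2 m - 1) <= m < 2 ^ Zdigits2 m)%Z.
Proof.
case: m => // m _; rewrite /Zdigits2 digits2_log2.
have := Z.log2_spec (Zpos m); rewrite -Z.add_1_r.
have -> : (Z.log2 (Zpos m) + 1 - 1 = Z.log2 (Zpos m))%Z by lia.
exact.
Qed.

Lemma Zdigits2_ge0 m : (0 <= Zdigits2 m)%Z.
Proof. by case: m. Qed.

Lemma Zdigits2_le m n : (0 < m < 2 ^ n)%Z -> (Zdigits2 m <= n)%Z.
Proof.
move=> [m_gt0 m_lt]; have [+ _] := Zdigits2_bounds m_gt0 => le_m.
have [n_ge0|n_lt0] := Z.le_gt_cases 0 n; last by rewrite Z.pow_neg_r in m_lt; lia.
have : (Zdigits2 m - 1 < n)%Z by apply/(Z.pow_lt_mono_r_iff 2); lia.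
lia.
Qed.

Lemma Zdigits2_ge m n : (0 <= n)%Z -> (2 ^ n <= m)%Z -> (n < Zdigits2 m)%Z.
Proof.
move=> n_ge0 le_m.
have pn := Z.pow_pos_nonneg 2 n.
have m_gt0 : (0 < m)%Z by lia.
have [_ lt_m] := Zdigits2_bounds m_gt0.
have d_ge0 := @Zdigits2_ge0 m.
by apply/(Z.pow_lt_mono_r_iff 2); lia.
Qed.

(** * Right shifts with round and sticky bits *)

(** [shr_r] is the bit of [x] of weight 1/2, and [shr_s] tells whether some bit
    of [x] below it is set. *)
Definition shr_spec (mrs : shr_record) (x : R) : Prop :=
  (0 <= shr_m mrs)%Z /\
  let f := x - IZR (shr_m mrs) in
  match shr_r mrs, shr_s mrs with
  | false, false => f = 0
  | false, true => 0 < f < 1 / 2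
  | true, false => f = 1 / 2
  | true, true => 1 / 2 < f < 1
  end.

Lemma shr_spec_floor mrs x : shr_spec mrs x ->
  IZR (shr_m mrs) <= x < IZR (shr_m mrs) + 1.
Proof. by case=> _; case: shr_r; case: shr_s; lra. Qed.

Lemma shr_1_spec mrs x : shr_spec mrs x -> shr_spec (shr_1 mrs) (x / 2).
Proof.
case: mrs => [[|[m|m|]|m] r s] [] //= _ H; split => //=.
- by case: r s H => [] [] /=; lra.
- by move: H; rewrite (Pos2Z.inj_xI m) plus_IZR mult_IZR; case: r s => [] [] /=; lra.
- by move: H; rewrite (Pos2Z.inj_xO m) mult_IZR; case: r s => [] [] /=; lra.
- by case: r s H => [] [] /=; lra.
Qed.

Lemma iter_shr_1_spec n mrs x :
  shr_spec mrs x -> shr_spec (iter_pos shr_1 n mrs) (x / pow2 (Zpos n)).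
Proof.
elim: n mrs x => [n IH|n IH|] mrs x H.
- rewrite (Pos2Z.inj_xI n) -(Z.add_diag (Zpos n)) !pow2_add.
  have -> : x / (pow2 (Zpos n) * pow2 (Zpos n) * pow2 1)
          = x / 2 / pow2 (Zpos n) / pow2 (Zpos n).
    by rewrite (powerRZ_1 2); field; have := pow2_gt0 (Zpos n); lra.
  exact/IH/IH/shr_1_spec.
- rewrite (Pos2Z.inj_xO n) -(Z.add_diag (Zpos n)) !pow2_add.
  have -> : x / (pow2 (Zpos n) * pow2 (Zpos n))
          = x / pow2 (Zpos n) / pow2 (Zpos n).
    by field; have := pow2_gt0 (Zpos n); lra.
  exact/IH/IH.
- by rewrite (powerRZ_1 2); apply: shr_1_spec.
Qed.

Lemma round_nearest_even_spec mrs x : shr_spec mrs x ->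
  let N := round_nearest_even (shr_m mrs) (loc_of_shr_record mrs) in
  (shr_m mrs <= N <= shr_m mrs + 1)%Z /\ Rabs (x - IZR N) <= 1 / 2.
Proof.
case: mrs => m r s [] /= m_ge0.
rewrite /round_nearest_even.
case: r s => [] [] /=; case: (Z.even m) => H; (split; first lia);
  by rewrite ?plus_IZR; apply: Rabs_le; lra.
Qed.

(** Two distinct integers are at distance at least one, so an integer within 1/2
    of [x] cannot be beaten. *)
Lemma nearest_int x N k : Rabs (x - IZR N) <= 1 / 2 ->
  Rabs (x - IZR N) <= Rabs (x - IZR k).
Proof.
move=> xN; have [->|neq_kN] := Z.eq_dec k N; first lra.
have : 1 <= Rabs (IZR k - IZR N).
  rewrite -minus_IZR -abs_IZR; apply: IZR_le; lia.
have := Rabs_triang (x - IZR N) (- (x - IZR k)); rewrite Rabs_Ropp.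
have -> : x - IZR N + - (x - IZR k) = IZR k - IZR N by lra.
lra.
Qed.

(** * Elementary facts on integers and reals *)

Lemma IZR_cond_Zopp s m : IZR (cond_Zopp s m) = if s then - IZR m else IZR m.
Proof. by case: s; rewrite ?opp_IZR. Qed.

Lemma Zpos_iter_xO m n : Zpos (Pos.iter xO m n) = (Zpos m * 2 ^ Zpos n)%Z.
Proof. by rewrite Z.mul_comm; exact: Zpower.shift_pos_correct. Qed.

Lemma Zpow2_gt1 n : (0 < n)%Z -> (1 < 2 ^ n)%Z.
Proof. by move=> n_gt0; apply/Z.pow_gt_1. Qed.

Lemma Rabs_div_le1 a b : 0 < b -> Rabs a <= b -> Rabs (a / b) <= 1.
Proof.
move=> b_gt0 le_ab; have E : a / b * b = a by field; lra.
have : Rabs (a / b) * b <= b; last nra.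
by rewrite -{2}(Rabs_pos_eq b) -?Rabs_mult ?E; lra.
Qed.

Lemma sqrt_sum_sqr_le x y B : 0 <= B ->
  sqrt (x ^ 2 + y ^ 2) <= B <-> Rabs x * Rabs x + Rabs y * Rabs y <= B * B.
Proof.
move=> B_ge0; have sum_ge0 : 0 <= x ^ 2 + y ^ 2 by nra.
rewrite -!Rabs_mult !(Rabs_pos_eq (_ * _)); try nra.
split=> [le_B|le_B].
  have := sqrt_sqrt _ sum_ge0; have := sqrt_pos (x ^ 2 + y ^ 2); nra.
by rewrite -(sqrt_square B) //; apply: sqrt_le_1_alt; lra.
Qed.

(** * Representable numbers and rounding to nearest *)

Section Format.
Context (p w : Z) (hp : (23 <= p)%Z) (hw : (p + 1 < 2 ^ (w - 1))%Z).
Local Notation prec := (fprec p).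
Local Notation emax := (femax w).
Local Notation emin := (SpecFloat.emin (fprec p) (femax w)).
Local Notation fexp := (SpecFloat.fexp (fprec p) (femax w)).
Local Notation nu := (nu p w).
Local Notation is_float := (is_float p w).

(** The exponent is unbounded above: rounding is specified first, and overflow is
    then the event that the rounded value exceeds [nu]. *)
Definition representable (v : R) : Prop := exists m e : Z,
  [/\ (Z.abs m < 2 ^ prec)%Z, (emin <= e)%Z & v = IZR m * pow2 e].

(** The tie-breaking rule is left out, so this is a relation; it is still
    monotone with respect to representable bounds, by [nearest_le] and
    [nearest_ge]. *)
Definition nearest (v r : R) : Prop :=
  representable r /\ forall f, representable f -> Rabs (v - r) <= Rabs (v - f).

Variant rounds (v : R) : spec_float -> Prop :=
| RoundsFinite x of is_float x & nearest v (value x) : rounds v x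
| RoundsOverflow s r of nearest v r & nu < Rabs r : rounds v (S754_infinity s).

Lemma prec_ge : (24 <= prec)%Z.
Proof. by rewrite /fprec; lia. Qed.

Lemma emax_gt : (prec < emax)%Z.
Proof. exact: hw. Qed.

Lemma nuE : nu = pow2 emax - pow2 (emax - prec).
Proof.
have hprec := prec_ge.
rewrite /Defs.nu /fnu /SFmax_float /value /=.
have E : Zpos (Pos.iter xO 1%positive (Z.to_pos prec)) = (2 ^ prec)%Z.
  by rewrite Zpos_iter_xO Z2Pos.id; lia.
have gt1 : (1 < 2 ^ prec)%Z by apply: Zpow2_gt1; lia.
rewrite Pos2Z.inj_sub; last by move: E; lia.
rewrite E minus_IZR pow2_IZR; last lia.
have -> : emax = (prec + (emax - prec))%Z by lia.
rewrite pow2_add; have -> : (prec + (emax - prec) - prec = emax - prec)%Z by lia.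
ring.
Qed.

(** A significand of absolute value 2^prec can be halved exactly, so that the
    next exponent represents the number. *)
Lemma representable_intro m e :
  (Z.abs m <= 2 ^ prec)%Z -> (emin <= e)%Z -> representable (IZR m * pow2 e).
Proof.
move=> le_m le_e; have hprec := prec_ge.
have P : (2 ^ prec = 2 * 2 ^ (prec - 1))%Z.
  by rewrite -Z.pow_succ_r; [congr (_ ^ _)%Z|]; lia.
have Q : (0 < 2 ^ (prec - 1))%Z by apply: Z.pow_pos_nonneg; lia.
have [lt_m|ge_m] := Z.lt_ge_cases (Z.abs m) (2 ^ prec).
  by exists m, e.
exists (Z.sgn m * 2 ^ (prec - 1))%Z, (e + 1)%Z; split; try lia.
rewrite pow2_add (powerRZ_1 2).
have -> : m = (2 * (Z.sgn m * 2 ^ (prec - 1)))%Z by lia.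
have -> : Z.sgn (2 * (Z.sgn m * 2 ^ (prec - 1))) = Z.sgn m by lia.
by rewrite [in LHS]mult_IZR; ring.
Qed.

Lemma representable_opp v : representable v -> representable (- v).
Proof.
by case=> m [e [? ? ->]]; exists (- m)%Z, e; split; rewrite ?opp_IZR; (try lia); ring.
Qed.

Lemma representable_pow2 e : (emin <= e)%Z -> representable (pow2 e).
Proof.
move=> ?; rewrite -(Rmult_1_l (pow2 e)); apply: representable_intro => //.
by have := prec_ge; have := @Zpow2_gt1 prec; lia.
Qed.

Lemma representable_0 : representable 0.
Proof.
rewrite -(Rmult_0_l (pow2 emin)); apply: representable_intro; last lia.
by have := prec_ge; have := @Zpow2_gt1 prec; lia.
Qed.

Lemma representable_value x : is_float x -> representable (value x).
Proof.
case: x => [s|s||s m e] //=; try by move=> _; exact: representable_0.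
rewrite /Defs.is_float /= andbT => /andP[/Z.eqb_eq E _].
apply: representable_intro; last by rewrite -E /SpecFloat.fexp; lia.
have -> : Z.abs (cond_Zopp s (Z.pos m)) = Z.pos m by case: s.
have [_ lt_m] := @Zdigits2_bounds (Zpos m) erefl.
have : (2 ^ (Zdigits2 (Z.pos m)) <= 2 ^ prec)%Z; last lia.
by apply: Z.pow_le_mono_r; move: E; rewrite /SpecFloat.fexp /Zdigits2; lia.
Qed.

(** Representable numbers with a smaller exponent than [e] may lie off the grid
    of step 2^e, but they are all small. *)
Lemma representable_grid f e : representable f ->
  (exists k, f = IZR k * pow2 e) \/
  (emin < e)%Z /\ Rabs f <= pow2 (prec - 1 + e).
Proof.
move=> [m [e' [lt_m ge_e' ->]]]; have hprec := prec_ge.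
have [le_ee'|lt_e'e] := Z.le_gt_cases e e'.
  left; exists (m * 2 ^ (e' - e))%Z.
  rewrite mult_IZR pow2_IZR; last lia.
  by rewrite Rmult_assoc -pow2_add; congr (_ * pow2 _); lia.
right; split; first lia.
apply: (Rle_trans _ (pow2 (prec + e'))); last by apply: pow2_le; lia.
have ? := pow2_gt0 e'.
rewrite pow2_add Rabs_mult (Rabs_pos_eq (pow2 e')); last lra.
apply: Rmult_le_compat_r; first lra.
by rewrite -abs_IZR -(@pow2_IZR prec); [apply: IZR_le|]; lia.
Qed.

Lemma dist_scale v k e :
  Rabs (v - IZR k * pow2 e) = Rabs (v / pow2 e - IZR k) * pow2 e.
Proof.
have e_gt0 := pow2_gt0 e.
rewrite -{3}(Rabs_pos_eq (pow2 e)); last lra.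
by rewrite -Rabs_mult; congr Rabs; field; lra.
Qed.

(** Rounding to an integer multiple of 2^e is rounding to nearest as soon as [v]
    has [prec] bits above 2^e, or 2^e is the smallest positive number: numbers
    off the grid are then no closer to [v] than the grid point 2^(prec-1+e). *)
Lemma nearest_grid v e N : (emin <= e)%Z ->
    e = emin \/ pow2 (e + prec - 1) <= v ->
    (0 <= N <= 2 ^ prec)%Z -> Rabs (v / pow2 e - IZR N) <= 1 / 2 ->
  nearest v (IZR N * pow2 e).
Proof.
move=> le_e norm [N_ge0 N_le] vN; split.
  by apply: representable_intro => //; lia.
have e_gt0 := pow2_gt0 e; have hprec := prec_ge.
have grid k : Rabs (v - IZR N * pow2 e) <= Rabs (v - IZR k * pow2 e).
  rewrite !dist_scale; apply: Rmult_le_compat_r; first lra.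
  exact: nearest_int.
move=> f rep_f; have [[k ->]|[lt_e le_f]] := representable_grid e rep_f.
  exact: grid.
case: norm => [|norm]; first by lia.
(* The grid point 2^(prec-1+e) lies between f and v. *)
have := grid (2 ^ (prec - 1))%Z; rewrite pow2_IZR -?pow2_add; last lia.
have {norm} : pow2 (prec - 1 + e) <= v.
  by have -> : (prec - 1 + e = e + prec - 1)%Z by lia.
move=> norm H; have ? := Rle_abs f.
rewrite (Rabs_pos_eq (v - pow2 _)) in H; last lra.
by rewrite (Rabs_pos_eq (v - f)); lra.
Qed.

Lemma nearest_opp v r : nearest v r -> nearest (- v) (- r).
Proof.
case=> rep_r H; split; first exact: representable_opp.
move=> f /representable_opp /H.
rewrite -(Rabs_Ropp (v - r)) -(Rabs_Ropp (v - - f)).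
have -> : - (v - r) = - v - - r by ring.
by have -> : - (v - - f) = - v - f by ring.
Qed.

(** * The rounding function *)

(** The hypothesis on [e] says that the significand has enough bits: shifting
    can discard bits but cannot supply missing ones. *)
Lemma shr_fexp_spec m e l v : shr_spec (shr_record_of_loc m l) (v / pow2 e) ->
    (e <= fexp (Zdigits2 m + e))%Z ->
  let res := shr_fexp prec emax m e l in
  res.2 = fexp (Zdigits2 m + e) /\ shr_spec res.1 (v / pow2 res.2).
Proof.
move=> H le_e; rewrite /shr_fexp.
have : (fexp (Zdigits2 m + e) = e + (fexp (Zdigits2 m + e) - e))%Z by lia.
case E: (fexp (Zdigits2 m + e) - e)%Z => [|n|n] //= ->; last by lia.
  by rewrite Z.add_0_r.
split => //.
have -> : v / pow2 (e + Zpos n) = v / pow2 e / pow2 (Zpos n).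
  by rewrite pow2_add; field; split; apply: Rgt_not_eq; exact: pow2_gt0.
exact: iter_shr_1_spec.
Qed.

(** The second shift of the rounding function is exact: it does something only
    after a carry, when [N] = 2^prec is even.  What it returns is in canonical
    form, so that the test on the exponent detects overflow. *)
Lemma rounds_renormalize s v N e :
    nearest v (IZR N * pow2 e) -> (0 <= N <= 2 ^ prec)%Z -> (emin <= e)%Z ->
    e = emin \/ (emin < e)%Z /\ (2 ^ (prec - 1) <= N)%Z ->
  rounds (if s then - v else v)
    (let '(mrs, e') := shr_fexp prec emax N e loc_Exact in
     match shr_m mrs with
     | Z0 => S754_zero s
     | Zpos m => if Z.leb e' (emax - prec) then S754_finite s m e'
                 else S754_infinity s
     | Zneg _ => S754_nan
     end).
Proof.
move=> near [N_ge0 N_le] le_e ge_N.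
have hprec := prec_ge; have hemax := emax_gt; have e_gt0 := pow2_gt0 e.
have P : (2 ^ prec = 2 * 2 ^ (prec - 1))%Z.
  by rewrite -Z.pow_succ_r; [congr (_ ^ _)%Z|]; lia.
have Q : (0 < 2 ^ (prec - 1))%Z by apply: Z.pow_pos_nonneg; lia.
have shr_N : shr_spec (shr_record_of_loc N loc_Exact) (IZR N * pow2 e / pow2 e).
  by split => /=; [lia | field; lra].
have le_e' : (e <= fexp (Zdigits2 N + e))%Z.
  rewrite /SpecFloat.fexp; case: ge_N => [|[_ ge_N]]; first lia.
  have := Zdigits2_ge _ ge_N; lia.
have [] := shr_fexp_spec shr_N le_e'.
case: (shr_fexp _ _ N e _) => mrs e' /= ->.
move=> /[dup] [[m_ge0 _]] /shr_spec_floor.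
move: m_ge0; set m := shr_m mrs => m_ge0 floor_m.
have [e2 [E2 [eq_m lt_m canon]]] : exists e2, fexp (Zdigits2 N + e) = e2 /\
    [/\ IZR m * pow2 e2 = IZR N * pow2 e, (m < 2 ^ prec)%Z
      & (0 < m)%Z -> fexp (Zdigits2 m + e2) = e2].
  move: floor_m; have [lt_N|ge_N'] := Z.lt_ge_cases N (2 ^ prec).
    have -> : fexp (Zdigits2 N + e) = e.
      have : (Zdigits2 N <= prec)%Z.
        have [N_gt0|N_le0] := Z.lt_ge_cases 0 N; first exact: Zdigits2_le.
        have -> : N = 0%Z by lia.
        by rewrite /Zdigits2; lia.
      by move: le_e'; rewrite /SpecFloat.fexp; lia.
    have -> : IZR N * pow2 e / pow2 e = IZR N by field; lra.
    rewrite -plus_IZR => [[/le_IZR le_m /lt_IZR ge_m]].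
    have -> : m = N by lia.
    exists e; do !split => //.
    move=> N_gt0; have := Zdigits2_le (conj N_gt0 lt_N).
    by move: le_e'; rewrite /SpecFloat.fexp; lia.
  have EN : N = (2 ^ prec)%Z by lia.
  have -> : fexp (Zdigits2 N + e) = (e + 1)%Z.
    have : (Zdigits2 N <= prec + 1)%Z.
      by apply: Zdigits2_le; rewrite Z.pow_add_r; lia.
    by have := @Zdigits2_ge N prec; rewrite /SpecFloat.fexp; lia.
  have -> : IZR N * pow2 e / pow2 (e + 1) = IZR (2 ^ (prec - 1)).
    by rewrite EN P mult_IZR pow2_add (powerRZ_1 2); field; lra.
  rewrite -plus_IZR => [[/le_IZR le_m /lt_IZR ge_m]].
  have -> : m = (2 ^ (prec - 1))%Z by lia.
  exists (e + 1)%Z; do !split => //; last 2 first.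
  - by lia.
  - have := @Zdigits2_le (2 ^ (prec - 1)) prec.
    by have := @Zdigits2_ge (2 ^ (prec - 1)) (prec - 1); rewrite /SpecFloat.fexp; lia.
  by rewrite EN P mult_IZR pow2_add (powerRZ_1 2); ring.
rewrite E2.
have near_s : nearest (if s then - v else v)
                (if s then - (IZR m * pow2 e2) else IZR m * pow2 e2).
  by rewrite eq_m; case: (s) => //; exact: nearest_opp.
case Em: m m_ge0 canon lt_m near_s => [|q|q] // _ canon lt_m near_s.
  by apply: RoundsFinite => //=; move: near_s; rewrite Rmult_0_l Ropp_0; case: (s).
have {}canon := canon erefl.
case: Z.leb_spec => [e2_le|e2_gt].
  apply: RoundsFinite; last first.
    rewrite /value IZR_cond_Zopp; move: near_s; case: (s) => //.
    by rewrite Ropp_mult_distr_l.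
  rewrite /Defs.is_float /= andbT /bounded /canonical_mantissa.
  by apply/andP; split; [exact/Z.eqb_eq | exact/Z.leb_le].
apply: RoundsOverflow near_s _; have e2_gt0 := pow2_gt0 e2.
have dq : Zdigits2 (Zpos q) = prec.
  by move: canon; rewrite /SpecFloat.fexp /SpecFloat.emin; lia.
have [ge_q _] := @Zdigits2_bounds (Zpos q) erefl.
have r_ge : pow2 emax <= IZR (Zpos q) * pow2 e2.
  apply: (Rle_trans _ (pow2 (prec - 1 + e2))); first by apply: pow2_le; lia.
  rewrite pow2_add; apply: Rmult_le_compat_r; first lra.
  by rewrite -(@pow2_IZR (prec - 1)); last lia; apply: IZR_le; rewrite -dq.
have := pow2_gt0 (emax - prec); have := pow2_gt0 emax; rewrite nuE => ? ?.
by case: (s); rewrite ?Rabs_Ropp Rabs_pos_eq; lra.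
Qed.

(** The hypothesis on [e] makes the exponent after the first shift the one at
    which [v] has [prec] bits (or [emin]); [nearest_grid] then applies. *)
Lemma binary_round_aux_spec s m e l v :
    shr_spec (shr_record_of_loc m l) (v / pow2 e) ->
    (e <= fexp (Zdigits2 m + e))%Z ->
  rounds (if s then - v else v) (binary_round_aux prec emax s m e l).
Proof.
move=> H le_e; have hprec := prec_ge; have hemax := emax_gt.
have e_gt0 := pow2_gt0 e.
have eqm : shr_m (shr_record_of_loc m l) = m by case: l {H} => [|[]].
have [] := shr_fexp_spec H le_e.
have := shr_spec_floor H; rewrite eqm => floor_m.
have m_ge0 : (0 <= m)%Z by case: H; rewrite eqm.
set d := Zdigits2 m in le_e *.
rewrite /binary_round_aux; case: (shr_fexp _ _ m e l) => mrs' e1 /= -> {e1}.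
set e1 := fexp (d + e) => H1; have e1_gt0 := pow2_gt0 e1.
have e1E : e1 = Z.max (d + e - prec) emin by [].
have ve : v / pow2 e * pow2 e = v by field; lra.
have ve1 : v / pow2 e1 * pow2 e1 = v by field; lra.
have d_ge0 : (0 <= d)%Z by exact: Zdigits2_ge0.
(* The bits of m bound v from both sides, m being the integer part of v / 2^e. *)
have lt_md : (m < 2 ^ d)%Z.
  have [m_gt0|m_le0] := Z.lt_ge_cases 0 m; first by case: (Zdigits2_bounds m_gt0).
  have -> : m = 0%Z by lia.
  by apply: Z.pow_pos_nonneg; lia.
have lt_v : v < pow2 (e1 + prec).
  apply: (Rlt_le_trans _ (pow2 (d + e))); last by apply: pow2_le; lia.
  rewrite -ve pow2_add; apply: Rmult_lt_compat_r => //.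
  rewrite -(@pow2_IZR d) //; have : IZR (m + 1) <= IZR (2 ^ d) by apply: IZR_le; lia.
  by rewrite plus_IZR; lra.
have norm : e1 = emin \/ (emin < e1)%Z /\ pow2 (e1 + prec - 1) <= v.
  have [|lt_e1] : e1 = emin \/ (emin < e1)%Z by lia.
    by left.
  right; split => //; have -> : (e1 + prec - 1 = d - 1 + e)%Z by lia.
  have m_gt0 : (0 < m)%Z.
    have [//|m_le0] := Z.lt_ge_cases 0 m.
    have d0 : d = 0%Z by have m0 : m = 0%Z; [lia | rewrite /d m0].
    by move: le_e; rewrite /SpecFloat.fexp; lia.
  have [le_m _] := Zdigits2_bounds m_gt0.
  have d_gt0 : (0 <= d - 1)%Z.
    by have := Zdigits2_ge (Z.le_refl 0); move/(_ m); rewrite -/d; lia.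
  rewrite -ve pow2_add; apply: Rmult_le_compat_r; first lra.
  rewrite -(@pow2_IZR (d - 1)) //; have := IZR_le _ _ le_m; rewrite -/d; lra.
have := round_nearest_even_spec H1.
have := shr_spec_floor H1.
case: (H1) => m1_ge0 _; move: m1_ge0.
set m1 := shr_m mrs'; set N := round_nearest_even _ _.
move=> m1_ge0 floor_m1 /= [N_bnd near_N].
have P : (2 ^ prec = 2 * 2 ^ (prec - 1))%Z.
  by rewrite -Z.pow_succ_r; [congr (_ ^ _)%Z|]; lia.
have Q : (0 < 2 ^ (prec - 1))%Z by apply: Z.pow_pos_nonneg; lia.
have lt_m1 : (m1 < 2 ^ prec)%Z.
  apply: lt_IZR; rewrite pow2_IZR; last lia.
  apply: (Rle_lt_trans _ (v / pow2 e1)); first lra.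
  by move: lt_v; rewrite -{1}ve1 Z.add_comm pow2_add; nra.
have near : nearest v (IZR N * pow2 e1).
  apply: nearest_grid => //; [lia | | lia].
  by case: norm => [|[]]; [left | right].
have ge_N : e1 = emin \/ (emin < e1)%Z /\ (2 ^ (prec - 1) <= N)%Z.
  case: norm => [|[? norm]]; [by left|right; split=> //].
  have : (2 ^ (prec - 1) < m1 + 1)%Z; last lia.
  apply: lt_IZR; rewrite pow2_IZR ?plus_IZR; last lia.
  apply: (Rle_lt_trans _ (v / pow2 e1)); last lra.
  move: norm; rewrite -{1}ve1; have -> : (e1 + prec - 1 = prec - 1 + e1)%Z by lia.
  by rewrite pow2_add; nra.
apply: rounds_renormalize => //; lia.
Qed.

(** * The operations return a nearest representable number *)

Lemma nearest_refl v : representable v -> nearest v v.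
Proof.
by move=> rep_v; split=> // f _; rewrite Rminus_diag Rabs_R0; exact: Rabs_pos.
Qed.

Lemma rounds_value x : is_float x -> rounds (value x) x.
Proof.
by move=> Fx; apply: RoundsFinite => //; apply: nearest_refl; exact: representable_value.
Qed.

Lemma rounds_zero s : rounds 0 (S754_zero s).
Proof. exact: (@rounds_value (S754_zero s)). Qed.

Lemma shl_align_spec m e e' :
  (shl_align m e e').2 = Z.min e e' /\
  Zpos (shl_align m e e').1 = (Zpos m * 2 ^ (e - Z.min e e'))%Z.
Proof.
rewrite /shl_align; case E: (e' - e)%Z => [|n|n].
- have -> : Z.min e e' = e by lia.
  by rewrite Z.sub_diag Z.mul_1_r.
- have -> : Z.min e e' = e by lia.
  by rewrite Z.sub_diag Z.mul_1_r.
have -> : Z.min e e' = e' by lia.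
by have -> : (e - e')%Z = Zpos n by [lia]; rewrite -Zpos_iter_xO.
Qed.

Lemma value_finite s m e :
  value (S754_finite s m e) = if s then - (IZR (Zpos m) * pow2 e) else IZR (Zpos m) * pow2 e.
Proof. by rewrite /value IZR_cond_Zopp; case: s => //; ring. Qed.

Lemma value_finite_neq0 s m e : value (S754_finite s m e) <> 0.
Proof.
have : 0 < IZR (Zpos m) * pow2 e.
  by apply: Rmult_lt_0_compat; [exact: IZR_lt | exact: pow2_gt0].
by rewrite value_finite; case: s; lra.
Qed.

Lemma value_eq0 x : is_float x -> value x = 0 -> exists s, x = S754_zero s.
Proof.
case: x => [s|s||s m e] // _; first by exists s.
by move/value_finite_neq0.
Qed.

Lemma shr_spec_exact m e v : (0 <= m)%Z -> v = IZR m * pow2 e ->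
  shr_spec (shr_record_of_loc m loc_Exact) (v / pow2 e).
Proof.
move=> m_ge0 ->; split => //=.
by field; have := pow2_gt0 e; lra.
Qed.

Lemma binary_round_spec s m e :
  rounds (value (S754_finite s m e)) (binary_round prec emax s m e).
Proof.
rewrite value_finite /binary_round.
set ex := fexp _; have := shl_align_spec m e ex.
case: shl_align => m' e'; rewrite -[(m', e').1]/m' -[(m', e').2]/e' => -[Ee' Em'].
have [le_m _] := @Zdigits2_bounds (Zpos m) erefl.
have dm_gt0 : (0 < Zdigits2 (Zpos m))%Z by [].
have ge_d : (Zdigits2 (Zpos m) + e <= Zdigits2 (Zpos m') + e')%Z.
  suff : (Zdigits2 (Zpos m) - 1 + (e - e') < Zdigits2 (Zpos m'))%Z by lia.
  apply: Zdigits2_ge; first lia.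
  rewrite Z.pow_add_r; try lia.
  by rewrite Em' -Ee'; apply: Z.mul_le_mono_nonneg_r => //; apply: Z.pow_nonneg.
apply: binary_round_aux_spec.
  apply: shr_spec_exact => //.
  have -> : e = ((e - e') + e')%Z by lia.
  rewrite pow2_add Em' -Ee' mult_IZR pow2_IZR; last lia.
  by ring.
by move: Ee'; rewrite /ex /SpecFloat.fexp -/(Zdigits2 (Zpos m)); lia.
Qed.

Lemma binary_normalize_spec m e s :
  rounds (IZR m * pow2 e) (binary_normalize prec emax m e s).
Proof.
case: m => [|m|m]; first by rewrite Rmult_0_l; exact: rounds_zero.
- exact: (@binary_round_spec false).
- exact: (@binary_round_spec true).
Qed.

Lemma SFadd_finite s1 m1 e1 s2 m2 e2 :
  let x := S754_finite s1 m1 e1 in let y := S754_finite s2 m2 e2 in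
  rounds (value x + value y) (SFadd prec emax x y).
Proof.
rewrite /SFadd /=.
set e := Z.min e1 e2.
have H s m f : (e <= f)%Z -> IZR (cond_Zopp s (Zpos m)) * pow2 f =
    IZR (cond_Zopp s (Zpos (shl_align m f e).1)) * pow2 e.
  move=> le_ef; have [_ ->] := shl_align_spec m f e.
  have {1}-> : f = ((f - Z.min f e) + e)%Z by lia.
  rewrite pow2_add !IZR_cond_Zopp mult_IZR pow2_IZR; last lia.
  by case: s; ring.
rewrite (H s1 m1 e1); last lia.
rewrite (H s2 m2 e2); last lia.
by rewrite -Rmult_plus_distr_r -plus_IZR; exact: binary_normalize_spec.
Qed.

Lemma finite_of_float x : is_float x -> is_finite x.
Proof. by case/andP. Qed.

(** Addition returns its nonzero operand unrounded when the other one is zero;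
    this is why the operands have to be floating-point numbers. *)
Lemma fadd_rounds x y : is_float x -> is_float y ->
  rounds (value x + value y) (fadd p w x y).
Proof.
case: x => [s1|s1||s1 m1 e1] // Fx; case: y => [s2|s2||s2 m2 e2] // Fy.
- by rewrite Rplus_0_r; case: s1 s2 {Fx Fy} => [] []; exact: rounds_zero.
- by rewrite Rplus_0_l; exact: rounds_value.
- by rewrite Rplus_0_r; exact: rounds_value.
- exact: SFadd_finite.
Qed.

Lemma fma_rounds x y z : is_float x -> is_float y -> is_float z ->
  rounds (value x * value y + value z) (fma p w x y z).
Proof.
move=> Fx Fy Fz.
have zero s : rounds (0 + value z) (fadd p w (S754_zero s) z).
  exact: (@fadd_rounds (S754_zero s)).
case: x Fx => [s1|s1||s1 m1 e1] // _; case: y Fy => [s2|s2||s2 m2 e2] // _.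
- by rewrite Rmult_0_l; exact: zero.
- by rewrite Rmult_0_l; exact: zero.
- by rewrite Rmult_0_r; exact: zero.
have -> : value (S754_finite s1 m1 e1) * value (S754_finite s2 m2 e2)
        = value (S754_finite (xorb s1 s2) (m1 * m2) (e1 + e2)).
  by rewrite !value_finite pow2_add Pos2Z.inj_mul mult_IZR; case: s1 s2 => [] [] /=; ring.
case: z Fz {zero} => [s3|s3||s3 m3 e3] // _.
- by rewrite Rplus_0_r; exact: binary_round_spec.
- exact: SFadd_finite.
Qed.

Lemma float_canonical s m e : is_float (S754_finite s m e) ->
  e = Z.max (Zdigits2 (Zpos m) + e - prec) emin.
Proof. by rewrite /Defs.is_float /= andbT => /andP[/Z.eqb_eq]. Qed.

Lemma emin_lt0 : (emin < 0)%Z.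
Proof. by have := prec_ge; have := emax_gt; rewrite /SpecFloat.emin; lia. Qed.

(** The significands are multiplied without being aligned first; canonicity of
    the operands is what guarantees that the product has enough bits. *)
Lemma fmul_rounds x y : is_float x -> is_float y ->
  rounds (value x * value y) (fmul p w x y).
Proof.
case: x => [s1|s1||s1 m1 e1] // Fx; case: y => [s2|s2||s2 m2 e2] // Fy.
- by rewrite Rmult_0_l; exact: rounds_zero.
- by rewrite Rmult_0_l; exact: rounds_zero.
- by rewrite Rmult_0_r; exact: rounds_zero.
have -> : value (S754_finite s1 m1 e1) * value (S754_finite s2 m2 e2)
        = value (S754_finite (xorb s1 s2) (m1 * m2) (e1 + e2)).
  by rewrite !value_finite pow2_add Pos2Z.inj_mul mult_IZR; case: s1 s2 {Fx Fy} => [] [] /=; ring.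
rewrite value_finite; apply: binary_round_aux_spec; first exact: shr_spec_exact.
have := float_canonical Fx; have := float_canonical Fy; have := emin_lt0.
have [le_1 _] := @Zdigits2_bounds (Zpos m1) erefl.
have [le_2 _] := @Zdigits2_bounds (Zpos m2) erefl.
have d1_gt0 : (0 < Zdigits2 (Zpos m1))%Z by [].
have d2_gt0 : (0 < Zdigits2 (Zpos m2))%Z by [].
have : (Zdigits2 (Zpos m1) - 1 + (Zdigits2 (Zpos m2) - 1) < Zdigits2 (Zpos (m1 * m2)))%Z.
  apply: Zdigits2_ge; first lia.
  rewrite Z.pow_add_r; try lia.
  by rewrite Pos2Z.inj_mul; apply: Z.mul_le_mono_nonneg => //; apply: Z.pow_nonneg.
rewrite /SpecFloat.fexp; lia.
Qed.

(** For odd [n], 2 r = n is impossible, and comparing 2 r + 1 with [n] decides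
    between 2 r < n and 2 r > n. *)
Lemma new_location_spec q r n : (0 <= q)%Z -> (0 <= r < n)%Z ->
  shr_spec (shr_record_of_loc q (new_location n r)) (IZR q + IZR r / IZR n).
Proof.
move=> q_ge0 [r_ge0 lt_rn].
have n_gt0 : 0 < IZR n by apply: IZR_lt; lia.
have r_gt0 : r <> 0%Z -> 0 < IZR r by move=> ?; apply: IZR_lt; lia.
have r_lt : IZR r < IZR n by apply: IZR_lt.
have En : IZR r / IZR n * IZR n = IZR r by field; lra.
have lt_half : (2 * r < n)%Z -> IZR r / IZR n < 1 / 2.
  by move/IZR_lt; rewrite mult_IZR; nra.
have eq_half : (2 * r = n)%Z -> IZR r / IZR n = 1 / 2.
  by move=> E; have := mult_IZR 2 r; rewrite E => ?; nra.
have gt_half : (2 * r > n)%Z -> IZR r / IZR n > 1 / 2.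
  by move=> /Z.gt_lt/IZR_lt; rewrite mult_IZR; nra.
have -> : new_location n r = if Z.eqb r 0 then loc_Exact else loc_Inexact
    (if Z.even n then Z.compare (2 * r) n
     else match Z.compare (2 * r + 1) n with Gt => Gt | _ => Lt end).
  by rewrite /new_location; case: (Z.even n).
have div_gt0 : r <> 0%Z -> 0 < IZR r / IZR n by move/r_gt0; nra.
have div_lt1 : IZR r / IZR n < 1 by nra.
case: (Z.eqb_spec r 0) => [r0|r_neq0].
  by rewrite r0 Rdiv_0_l; (split; first by []); rewrite /=; lra.
have {}div_gt0 := div_gt0 r_neq0.
case even_n: (Z.even n).
  case: Z.compare_spec => H; (split; first by []); rewrite /=.
  - by have := eq_half H; lra.
  - by have := lt_half H; lra.
  - by have := gt_half (Z.lt_gt _ _ H); lra.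
have odd_n : (n <> 2 * r)%Z.
  by move=> E; move: even_n; rewrite E Z.even_mul.
case: Z.compare_spec => H; (split; first by []); rewrite /=.
- have : (2 * r < n)%Z by lia.
  by move/lt_half; lra.
- have : (2 * r < n)%Z by lia.
  by move/lt_half; lra.
- have : (2 * r > n)%Z by lia.
  by move/gt_half; lra.
Qed.

Lemma shiftl_match m s : (0 <= s)%Z ->
  match s with Zpos _ => Z.shiftl m s | Z0 => m | Zneg _ => Z0 end = (m * 2 ^ s)%Z.
Proof.
by case: s => [|s|s] // _; [lia | rewrite Z.shiftl_mul_pow2].
Qed.

Lemma fdiv_rounds x y : is_finite x -> is_finite y -> value y <> 0 ->
  rounds (value x / value y) (fdiv p w x y).
Proof.
case: x => [s1|s1||s1 m1 e1] // _; case: y => [s2|s2||s2 m2 e2] // _ y_neq0.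
  by rewrite Rdiv_0_l; exact: rounds_zero.
have m2_gt0 : 0 < IZR (Zpos m2) by exact: IZR_lt.
pose v := IZR (Zpos m1) / IZR (Zpos m2) * pow2 (e1 - e2).
have -> : value (S754_finite s1 m1 e1) / value (S754_finite s2 m2 e2)
        = if xorb s1 s2 then - v else v.
  have := pow2_gt0 e2; rewrite /v !value_finite /Z.sub pow2_add pow2_opp.
  by case: s1 s2 {y_neq0} => [] [] /= ?; field; lra.
rewrite /fdiv /SFdiv /SFdiv_core_binary.
set d1 := Zdigits2 (Zpos m1); set d2 := Zdigits2 (Zpos m2).
set E := (d1 + e1 - (d2 + e2))%Z; set e := Z.min (fexp E) (e1 - e2).
rewrite shiftl_match; last by lia.
set s := (e1 - e2 - e)%Z; have s_ge0 : (0 <= s)%Z by lia.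
have [le_1 lt_1] := @Zdigits2_bounds (Zpos m1) erefl.
have [le_2 lt_2] := @Zdigits2_bounds (Zpos m2) erefl.
have ps_gt0 : (0 < 2 ^ s)%Z by apply: Z.pow_pos_nonneg.
have := Z_div_mod (Zpos m1 * 2 ^ s) (Zpos m2) erefl.
case: Z.div_eucl => q r [Eq r_bnd].
have q_ge0 : (0 <= q)%Z by nia.
apply: binary_round_aux_spec.
  have -> : v / pow2 e = IZR q + IZR r / IZR (Zpos m2).
    have -> : IZR q = (IZR (Zpos m1) * pow2 s - IZR r) / IZR (Zpos m2).
      by rewrite -pow2_IZR // -mult_IZR Eq plus_IZR mult_IZR; field; lra.
    rewrite /v; have -> : (e1 - e2 = s + e)%Z by lia.
    by rewrite pow2_add; field; have := pow2_gt0 e; lra.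
  exact: new_location_spec.
(* Either q has the bits that E predicts, or e is at most emin. *)
have : (E - 1 < e)%Z \/ (E <= Zdigits2 q + e)%Z.
  have [?|ge_E] := Z.lt_ge_cases (E - 1) e; first by left.
  right; have := @Zdigits2_ge q (E - 1 - e).
  have d1_gt0 : (0 < d1)%Z by [].
  have d2_gt0 : (0 < d2)%Z by [].
  suff : (2 ^ (E - 1 - e) < q + 1)%Z by lia.
  have : (2 ^ (E - 1 - e) * 2 ^ d2 = 2 ^ (d1 - 1) * 2 ^ s)%Z.
    by rewrite -!Z.pow_add_r; try lia; congr (_ ^ _)%Z; lia.
  move: le_1 lt_2; rewrite -/d1 -/d2 => le_1 lt_2 P.
  have Q : (0 < 2 ^ (E - 1 - e))%Z by apply: Z.pow_pos_nonneg; lia.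
  nia.
have : e = Z.min (fexp E) (e1 - e2) by [].
by have := prec_ge; rewrite /SpecFloat.fexp; lia.
Qed.

Lemma fsqrt_rounds x : is_finite x -> 0 <= value x ->
  rounds (sqrt (value x)) (fsqrt p w x).
Proof.
case: x => [s|s||s m e] // _ x_ge0.
  by rewrite sqrt_0; exact: rounds_zero.
have m_gt0 : 0 < IZR (Zpos m) by exact: IZR_lt.
case: s x_ge0 => x_ge0.
  by have := pow2_gt0 e; move: x_ge0; rewrite value_finite; nra.
rewrite value_finite /fsqrt /SFsqrt /SFsqrt_core_binary.
set d := Zdigits2 (Zpos m); set E := Z.div2 (d + e + 1).
set f := Z.min (fexp E) (Z.div2 e).
have le_f : (2 * f <= e)%Z.
  by have := Z.div2_odd e; have : (0 <= Z.b2z (Z.odd e) <= 1)%Z; [case: Z.odd | lia].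
have le_E : (2 * E <= d + e + 1)%Z.
  rewrite /E; have := Z.div2_odd (d + e + 1).
  by have : (0 <= Z.b2z (Z.odd (d + e + 1)) <= 1)%Z; [case: Z.odd | lia].
rewrite shiftl_match; last by lia.
set s := (e - 2 * f)%Z; have s_ge0 : (0 <= s)%Z by lia.
have ps_gt0 : (0 < 2 ^ s)%Z by apply: Z.pow_pos_nonneg.
have := Z.sqrtrem_spec (Zpos m * 2 ^ s).
case: Z.sqrtrem => q r /(_ _)[|Eq r_bnd]; first by lia.
have q_ge0 : (0 <= q)%Z by lia.
have [le_m lt_m] := @Zdigits2_bounds (Zpos m) erefl.
set v := sqrt _.
have v_ge0 : 0 <= v by exact: sqrt_pos.
have v2 : v * v = IZR (Zpos m) * pow2 e.
  by apply: sqrt_sqrt; have := pow2_gt0 e; nra.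
have f_gt0 := pow2_gt0 f.
apply: (@binary_round_aux_spec false).
  pose u := v / pow2 f.
  have u_ge0 : 0 <= u by exact: Rle_mult_inv_pos.
  have u2 : u * u = IZR q * IZR q + IZR r.
    rewrite -mult_IZR -plus_IZR -Eq mult_IZR pow2_IZR //.
    have -> : u * u = v * v / (pow2 f * pow2 f) by rewrite /u; field; lra.
    rewrite v2; have -> : (e = s + (f + f))%Z by lia.
    by rewrite !pow2_add; field; lra.
  (* As m' = q^2 + r, the root exceeds q + 1/2 exactly when r > q. *)
  rewrite -/u; have q_ge0' := IZR_le _ _ q_ge0.
  case: (Z.eqb_spec r 0) => [r0|r_neq0].
    by split=> //=; rewrite r0 in u2; nra.
  have r_ge1 : 1 <= IZR r by apply: IZR_le; lia.
  case: Z.leb_spec => cmp; split=> //=.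
    have : IZR r <= IZR q by exact: IZR_le.
    by nra.
  have : IZR q + 1 <= IZR r by rewrite -plus_IZR; apply: IZR_le; lia.
  have : IZR r <= 2 * IZR q by rewrite -mult_IZR; apply: IZR_le; lia.
  by nra.
(* Either q has the bits that E predicts, or f is at most emin. *)
have : (E - 1 < f)%Z \/ (E <= Zdigits2 q + f)%Z.
  have [?|ge_E] := Z.lt_ge_cases (E - 1) f; first by left.
  right; have := @Zdigits2_ge q (E - 1 - f).
  have d_gt0 : (0 < d)%Z by [].
  suff : (2 ^ (E - 1 - f) < q + 1)%Z by lia.
  have P : (2 ^ (E - 1 - f) * 2 ^ (E - 1 - f) <= 2 ^ (d - 1) * 2 ^ s)%Z.
    by rewrite -!Z.pow_add_r; try lia; apply: Z.pow_le_mono_r; lia.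
  move: le_m; rewrite -/d => le_m.
  have Q : (0 < 2 ^ (E - 1 - f))%Z by apply: Z.pow_pos_nonneg; lia.
  nia.
have : f = Z.min (fexp E) (Z.div2 e) by [].
by have := prec_ge; rewrite /SpecFloat.fexp; lia.
Qed.

(** * Bounds preserved by rounding *)

Lemma representable_succ f m e : representable f -> (2 ^ (prec - 1) <= m)%Z ->
  IZR m * pow2 e < f -> IZR (m + 1) * pow2 e <= f.
Proof.
move=> rep_f le_m lt_f; have e_gt0 := pow2_gt0 e; have hprec := prec_ge.
have [[k Ef]|[_ le_f]] := representable_grid e rep_f.
  rewrite Ef in lt_f *; apply: Rmult_le_compat_r; first lra.
  apply: IZR_le; have : (m < k)%Z; last lia.
  apply: lt_IZR; exact: (Rmult_lt_reg_r _ _ _ e_gt0).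
have := IZR_le _ _ le_m; rewrite pow2_IZR; last lia.
have := Rle_abs f; rewrite pow2_add in le_f; nra.
Qed.

Lemma representable_pred f m e : representable f -> (2 ^ (prec - 1) < m)%Z ->
  f < IZR m * pow2 e -> f <= IZR (m - 1) * pow2 e.
Proof.
move=> rep_f le_m lt_f; have e_gt0 := pow2_gt0 e; have hprec := prec_ge.
have [[k Ef]|[_ le_f]] := representable_grid e rep_f.
  rewrite Ef in lt_f *; apply: Rmult_le_compat_r; first lra.
  apply: IZR_le; have : (k < m)%Z; last lia.
  apply: lt_IZR; exact: (Rmult_lt_reg_r _ _ _ e_gt0).
have : IZR (2 ^ (prec - 1)) <= IZR (m - 1) by apply: IZR_le; lia.
rewrite pow2_IZR; last lia.
have := Rle_abs f; rewrite pow2_add in le_f; nra.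
Qed.

(** Rounding past a representable bound would be worse than rounding to it. *)
Lemma nearest_le v r B : nearest v r -> representable B -> v <= B -> r <= B.
Proof.
move=> [_ near] rep_B le_vB; have := near _ rep_B.
rewrite [Rabs (v - B)]Rabs_minus_sym (Rabs_pos_eq (B - v)); last lra.
by have := Rle_abs (r - v); rewrite Rabs_minus_sym; lra.
Qed.

Lemma nearest_ge v r B : nearest v r -> representable B -> B <= v -> B <= r.
Proof.
move=> /nearest_opp near /representable_opp rep_B le_Bv.
by have := nearest_le near rep_B; lra.
Qed.

Lemma rounds_finite v x : rounds v x -> is_finite x ->
  is_float x /\ nearest v (value x).
Proof. by case. Qed.

(** The workhorse of all the bounds below; it excludes overflow as well. *)
Lemma rounds_le v x B : rounds v x -> Rabs v <= B -> representable B -> B <= nu ->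
  is_float x /\ Rabs (value x) <= B.
Proof.
move=> rnd_x le_v' rep_B le_B.
have le_v : v <= B by have := Rle_abs v; lra.
have ge_v : - B <= v by have := Rle_abs (- v); rewrite Rabs_Ropp; lra.
have bound r : nearest v r -> Rabs r <= B.
  move=> near; apply: Rabs_le; split.
  - by apply: (nearest_ge near) => //; exact: representable_opp.
  - exact: (nearest_le near).
case: rnd_x => [{}x Fx near|s r near gt_r]; first by split=> //; exact: bound.
by have := bound _ near; lra.
Qed.

Lemma rounds_ge v x B : rounds v x -> is_finite x -> representable B -> B <= v ->
  B <= value x.
Proof. by move=> rnd_x fin_x; have [_ near] := rounds_finite rnd_x fin_x; exact: nearest_ge. Qed.

Lemma rounds_ub v x B : rounds v x -> is_finite x -> representable B -> v <= B ->
  value x <= B.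
Proof. by move=> rnd_x fin_x; have [_ near] := rounds_finite rnd_x fin_x; exact: nearest_le. Qed.

(** The constant is 2^24, as [prec] is at least 24. *)
Lemma nu_bounds : pow2 emax * (1 - / 16777216) <= nu < pow2 emax.
Proof.
have hprec := prec_ge.
rewrite nuE; split; last by have := pow2_gt0 (emax - prec); lra.
have : pow2 (emax - prec) <= pow2 (emax - 24) by apply: pow2_le; lia.
rewrite /Z.sub (pow2_add emax (- (24))) pow2_opp.
have -> : pow2 24 = 16777216 by rewrite -pow2_IZR.
lra.
Qed.

Lemma nu_mantissaE : nu = IZR (2 ^ prec - 1) * pow2 (emax - prec).
Proof.
have hprec := prec_ge.
rewrite nuE minus_IZR pow2_IZR; last lia.
rewrite Rmult_minus_distr_r -pow2_add Rmult_1_l.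
by have -> : (prec + (emax - prec) = emax)%Z by lia.
Qed.

Lemma representable_nu : representable nu.
Proof.
have hprec := prec_ge; have hemax := emax_gt.
rewrite nu_mantissaE; apply: representable_intro; last by rewrite /SpecFloat.emin; lia.
by have := @Zpow2_gt1 prec; lia.
Qed.

Lemma representable_1 : representable 1.
Proof. by rewrite -pow2_0; apply: representable_pow2; have := emin_lt0; lia. Qed.

Lemma pow2_le_nu e : (e < emax)%Z -> pow2 e <= nu.
Proof.
move=> lt_e; have : pow2 e <= pow2 (emax - 1) by apply: pow2_le; lia.
rewrite /Z.sub pow2_add pow2_opp (powerRZ_1 2); have := nu_bounds.
have := pow2_gt0 emax; lra.
Qed.

Lemma nu_ge1 : 1 <= nu.
Proof. by rewrite -pow2_0; apply: pow2_le_nu; have := prec_ge; have := emax_gt; lia. Qed.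

(** * Signs and comparisons *)

Lemma f1_float : is_float (f1 p w) /\ value (f1 p w) = 1.
Proof.
have rnd : rounds 1 (f1 p w).
  have <- : value (S754_finite false 1 0) = 1 by rewrite /value /=; ring.
  exact: binary_round_spec.
have [] := rounds_le rnd _ representable_1 nu_ge1; first by rewrite Rabs_R1; lra.
move=> F1 _; split=> //; have fin1 := finite_of_float F1.
have := rounds_ge rnd fin1 representable_1; have := rounds_ub rnd fin1 representable_1.
lra.
Qed.

Lemma SFopp_float x : is_float x -> is_float (SFopp x) /\ value (SFopp x) = - value x.
Proof.
case: x => [s|s||s m e] // Fx; first by rewrite /= Ropp_0.
by split=> //; rewrite /= !IZR_cond_Zopp; case: s {Fx} => /=; ring.
Qed.

Lemma SFabs_float x : is_float x ->
  is_float (SFabs x) /\ value (SFabs x) = Rabs (value x).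
Proof.
case: x => [s|s||s m e] // Fx; first by rewrite /= Rabs_R0.
split=> //; rewrite [SFabs _]/= !value_finite.
have : 0 < IZR (Zpos m) * pow2 e.
  by apply: Rmult_lt_0_compat; [exact: IZR_lt | exact: pow2_gt0].
by case: (s) => ?; rewrite ?Rabs_Ropp Rabs_pos_eq //; lra.
Qed.

Lemma mul_sign_float x y : is_float x ->
  is_float (mul_sign x y) /\ Rabs (value (mul_sign x y)) = Rabs (value x).
Proof.
move=> Fx; rewrite /mul_sign; case: sign_bit; last by [].
by have [? ->] := SFopp_float Fx; rewrite Rabs_Ropp.
Qed.

(** Comparing exponents first is sound because both operands are canonical: a
    number with a larger exponent has a full significand. *)
Lemma compare_float m1 e1 m2 e2 :
    is_float (S754_finite false m1 e1) -> is_float (S754_finite false m2 e2) ->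
  let v1 := IZR (Zpos m1) * pow2 e1 in let v2 := IZR (Zpos m2) * pow2 e2 in
  CompareSpec (v1 = v2) (v1 < v2) (v2 < v1)
    match Z.compare e1 e2 with
    | Eq => Pos.compare_cont Eq m1 m2 | Lt => Lt | Gt => Gt end.
Proof.
have lt_exp m e m' e' : is_float (S754_finite false m e) ->
    is_float (S754_finite false m' e') -> (e < e')%Z ->
    IZR (Zpos m) * pow2 e < IZR (Zpos m') * pow2 e'.
  move=> /float_canonical Ee /float_canonical Ee' lt_e; have hprec := prec_ge.
  have [_ lt_m] := @Zdigits2_bounds (Zpos m) erefl.
  have [le_m' _] := @Zdigits2_bounds (Zpos m') erefl.
  apply: (Rlt_le_trans _ (pow2 (Zdigits2 (Zpos m) + e))).
    rewrite pow2_add; apply: Rmult_lt_compat_r; first exact: pow2_gt0.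
    by rewrite -pow2_IZR //; exact: IZR_lt.
  apply: (Rle_trans _ (pow2 (Zdigits2 (Zpos m') - 1 + e'))).
    by apply: pow2_le; lia.
  rewrite pow2_add; apply: Rmult_le_compat_r; first by have := pow2_gt0 e'; lra.
  have d_gt0 : (0 < Zdigits2 (Zpos m'))%Z by [].
  by rewrite -pow2_IZR; [exact: IZR_le | lia].
move=> F1 F2 /=; case: Z.compare_spec => [E|lt|lt].
- rewrite -E; have e_gt0 := pow2_gt0 e1.
  rewrite -/(Pos.compare m1 m2); case: Pos.compare_spec => [->|lt|lt].
  + exact: CompEq.
  + by apply: CompLt; apply: Rmult_lt_compat_r => //; exact: IZR_lt.
  + by apply: CompGt; apply: Rmult_lt_compat_r => //; exact: IZR_lt.
- by apply: CompLt; exact: lt_exp.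
- by apply: CompGt; exact: lt_exp.
Qed.

Lemma SFltb_float x y : is_float x -> is_float y ->
  if SFltb x y then value x < value y else value y <= value x.
Proof.
have pos m e : 0 < IZR (Zpos m) * pow2 e.
  by apply: Rmult_lt_0_compat; [exact: IZR_lt | exact: pow2_gt0].
case: x => [s1|s1||s1 m1 e1] // Fx; case: y => [s2|s2||s2 m2 e2] // Fy;
  rewrite ?value_finite /SFltb /=.
- lra.
- by have := pos m2 e2; case: (s2) => /=; lra.
- by have := pos m1 e1; case: (s1) => /=; lra.
have := pos m1 e1; have := pos m2 e2; have := @compare_float m1 e1 m2 e2 Fx Fy.
move=> /= cmp ? ?; case: (s1); case: (s2) => /=; try lra.
  have -> : match Z.compare e1 e2 with
            | Eq => CompOpp (Pos.compare_cont Eq m1 m2) | Lt => Gt | Gt => Lt end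
          = CompOpp (match Z.compare e1 e2 with
            | Eq => Pos.compare_cont Eq m1 m2 | Lt => Lt | Gt => Gt end).
    by case: Z.compare.
  by case: cmp => /=; lra.
by case: cmp; lra.
Qed.

Lemma min_of_float x y : is_float x -> is_float y ->
  is_float (min_of x y) /\ value (min_of x y) = Rmin (value x) (value y).
Proof.
move=> Fx Fy; have := SFltb_float Fy Fx; rewrite /min_of.
case: SFltb => H; split => //; first by rewrite Rmin_right; lra.
by rewrite Rmin_left.
Qed.

Lemma max_of_float x y : is_float x -> is_float y ->
  is_float (max_of x y) /\ value (max_of x y) = Rmax (value x) (value y).
Proof.
move=> Fx Fy; have := SFltb_float Fx Fy; rewrite /max_of.
case: SFltb => H; split => //; first by rewrite Rmax_right; lra.
by rewrite Rmax_left.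
Qed.

(** * The computed rotation *)

(** Since emax = 2 E, the root of [nu] = 2^emax (1 - u) with u = 2^-prec is just
    below the midpoint 2^E (1 - u / 2) of 2^E and its predecessor 2^E (1 - u), so
    it is rounded down. *)
Lemma sqrt_fnu : exists E, [/\ emax = (E + E)%Z, (0 < E)%Z,
  is_float (fsqrt p w (fnu p w))
  & 0 <= value (fsqrt p w (fnu p w)) <= pow2 E - pow2 (E - prec)].
Proof.
have hprec := prec_ge; have hemax := emax_gt.
have w_gt1 : (0 <= w - 2)%Z.
  have [//|lt_w] := Z.le_gt_cases 0 (w - 2).
  have : (emax <= 2 ^ 0)%Z by apply: Z.pow_le_mono_r; lia.
  by rewrite /=; lia.
have emaxE : emax = (2 ^ (w - 2) + 2 ^ (w - 2))%Z.
  rewrite /femax; have -> : (w - 1 = Z.succ (w - 2))%Z by lia.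
  by rewrite Z.pow_succ_r //; lia.
exists (2 ^ (w - 2))%Z; set E := (2 ^ (w - 2))%Z in emaxE *.
set a := pow2 E; set b := pow2 (E - prec).
have b_gt0 : 0 < b := pow2_gt0 _.
have lt_ba : b < a by apply: pow2_lt; lia.
have nuab : nu = a * a - a * b.
  by rewrite nuE emaxE -!pow2_add; congr (_ - pow2 _); lia.
have rnd : rounds (sqrt nu) (fsqrt p w (fnu p w)).
  by apply: fsqrt_rounds => //; have := nu_ge1; rewrite /Defs.nu; lra.
have root2 : sqrt nu * sqrt nu = nu by apply: sqrt_sqrt; have := nu_ge1; lra.
have root_ge0 : 0 <= sqrt nu := sqrt_pos _.
(* sqrt nu lies below the midpoint of a - b and a. *)
have lt_mid : sqrt nu < a - b / 2 by nra.
have [F _] : is_float (fsqrt p w (fnu p w)) /\ Rabs (value (fsqrt p w (fnu p w))) <= a.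
  apply: rounds_le rnd _ _ _; last by apply: pow2_le_nu; lia.
    by rewrite Rabs_pos_eq; lra.
  by apply: representable_pow2; have := emin_lt0; lia.
split=> //; first lia.
have [_ [rep_r near]] := rounds_finite rnd (finite_of_float F).
split; first exact: (rounds_ge rnd (finite_of_float F) representable_0).
have abE : a - b = IZR (2 ^ prec - 1) * b.
  have -> : a = pow2 (prec + (E - prec)) by congr pow2; lia.
  by rewrite pow2_add minus_IZR pow2_IZR /b; [ring|lia].
have [//|gt_r] := Rle_lt_dec (value (fsqrt p w (fnu p w))) (a - b).
have ge_r : a <= value (fsqrt p w (fnu p w)).
  have -> : a = IZR (2 ^ prec - 1 + 1) * b by rewrite plus_IZR; lra.
  rewrite abE in gt_r; apply: representable_succ gt_r => //.
  have : (2 ^ prec = 2 * 2 ^ (prec - 1))%Z.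
    by rewrite -Z.pow_succ_r; [congr (_ ^ _)%Z|]; lia.
  by have := @Zpow2_gt1 (prec - 1); lia.
have : representable (a - b).
  rewrite abE; apply: representable_intro; last by rewrite /SpecFloat.emin; lia.
  by have := @Zpow2_gt1 prec; lia.
move/near; rewrite Rabs_minus_sym Rabs_pos_eq; last lra.
by case: (Rcase_abs (sqrt nu - (a - b))) => ?;
  [rewrite Rabs_left | rewrite Rabs_right]; lra.
Qed.

(** With a = 2^E and b = 2^(E - prec), the bound on [t] is a - b and [nu] is
    a^2 - a b, which leaves room b (a - b) >= 1 for the added one, as
    emax > prec. *)
Lemma sqr_tau_le t E : emax = (E + E)%Z -> 0 <= t <= pow2 E - pow2 (E - prec) ->
  t * t + 1 <= nu.
Proof.
move=> emaxE [t_ge0 t_le]; have hprec := prec_ge; have hemax := emax_gt.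
rewrite nuE emaxE; have -> : (E + E - prec = E + (E - prec))%Z by lia.
have : 2 <= pow2 (E + (E - prec)).
  by have := @pow2_le 1 (E + (E - prec)); rewrite (powerRZ_1 2); apply; lia.
have : pow2 (E - prec) * 2 <= pow2 E.
  have := @pow2_le (E - prec + 1) E; rewrite pow2_add (powerRZ_1 2).
  by apply; lia.
rewrite (pow2_add E E) (pow2_add E (E - prec)).
have := pow2_gt0 (E - prec); move: t_le.
move: (pow2 E) (pow2 (E - prec)) => a b t_le b_gt0 le_ba le_2.
have : t * t <= (a - b) * (a - b) by apply: Rmult_le_compat.
nra.
Qed.

Lemma float_normal x : is_float x -> 1 < Rabs (value x) -> exists m e,
  [/\ Rabs (value x) = IZR m * pow2 e, (2 ^ (prec - 1) <= m < 2 ^ prec)%Z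
    & (- prec < e)%Z].
Proof.
have hprec := prec_ge; have hemax := emax_gt.
case: x => [s|s||s m e] // Fx; rewrite ?Rabs_R0; try lra.
have [_] := SFabs_float Fx; rewrite [SFabs _]/= value_finite => <- gt1.
have [le_m lt_m] := @Zdigits2_bounds (Zpos m) erefl.
have := float_canonical Fx; set d := Zdigits2 _ in le_m lt_m *.
have e_gt0 := pow2_gt0 e.
have lt_v : IZR (Zpos m) * pow2 e < pow2 (d + e).
  rewrite pow2_add -(@pow2_IZR d) //; apply: Rmult_lt_compat_r => //.
  exact: IZR_lt.
have de_gt0 : (0 < d + e)%Z.
  have [//|le_de] := Z.lt_ge_cases 0 (d + e).
  by have := pow2_le le_de; rewrite pow2_0; lra.
rewrite /SpecFloat.emin => canon.
have dE : d = prec by lia.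
by exists (Zpos m), e; rewrite -dE; split=> //; lia.
Qed.

(** The point is that rounding twice does not bring the root below t = |x|.
    Write t = m 2^e with 2^(prec-1) <= m < 2^prec.  If m is a power of two then
    so is t^2, and monotonicity is enough.  Otherwise t^2 + 1 is rounded to at
    least t^2 - 2^(prec-1) 2^(2e), while the root is rounded below t only if it
    is at most (m - 1/2) 2^e, whose square is smaller than that because
    m > 2^(prec-1). *)
Lemma sqrt_fma_ge x : is_float x -> value x * value x + 1 <= nu ->
  let c := fsqrt p w (fma p w x x (f1 p w)) in
  [/\ is_float c, 1 <= value c, Rabs (value x) <= value c
    & value c <= pow2 (emax - 2)].
Proof.
move=> Fx le_x; set y := fma _ _ _ _ _ => c; have hprec := prec_ge; have hemax := emax_gt.
have [F1 v1] := f1_float.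
have := fma_rounds Fx Fx F1; rewrite v1 -/y => rnd_y.
have [Fy le_y] : is_float y /\ Rabs (value y) <= nu.
  apply: (rounds_le rnd_y); [|exact: representable_nu|lra].
  by rewrite Rabs_pos_eq //; nra.
have fin_y := finite_of_float Fy.
have y_ge1 : 1 <= value y by apply: (rounds_ge rnd_y fin_y representable_1); nra.
rewrite Rabs_pos_eq in le_y; last lra.
have rnd_c : rounds (sqrt (value y)) c by apply: fsqrt_rounds fin_y _; lra.
have y2 : sqrt (value y) * sqrt (value y) = value y by apply: sqrt_sqrt; lra.
have sy_ge0 : 0 <= sqrt (value y) := sqrt_pos _.
have rep_half : representable (pow2 (emax - 2)).
  by apply: representable_pow2; have := emin_lt0; lia.
have sy_le : sqrt (value y) <= pow2 (emax - 2).
  have : nu <= pow2 (emax - 2) * pow2 (emax - 2).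
    apply: Rlt_le; apply: Rlt_le_trans (proj2 nu_bounds) _.
    by rewrite -pow2_add; apply: pow2_le; lia.
  by have := pow2_gt0 (emax - 2); nra.
have [Fc le_c] : is_float c /\ Rabs (value c) <= pow2 (emax - 2).
  apply: (rounds_le rnd_c); [by rewrite Rabs_pos_eq | by [] |].
  by apply: pow2_le_nu; lia.
have fin_c := finite_of_float Fc.
have c_ge1 : 1 <= value c.
  by apply: (rounds_ge rnd_c fin_c representable_1); nra.
split=> //; last by have := Rle_abs (value c); lra.
have [?|t_gt1] := Rle_lt_dec (Rabs (value x)) 1; first lra.
have [m [e [Et [le_m lt_m] gt_e]]] := float_normal Fx t_gt1.
have Et2 : value x * value x = Rabs (value x) * Rabs (value x).
  by rewrite -Rabs_mult Rabs_pos_eq //; nra.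
rewrite {}Et2 {}Et in le_x t_gt1 rnd_y *.
have q_gt0 := pow2_gt0 e; set q := pow2 e in le_x t_gt1 rnd_y q_gt0 *.
have gt_emin : (emin < - prec)%Z by rewrite /SpecFloat.emin; lia.
set t := IZR m * q in le_x t_gt1 rnd_y *.
have rep_t : representable t by apply: representable_intro; lia.
have [_ near_y] := rounds_finite rnd_y fin_y.
have [Em|gt_m] : m = (2 ^ (prec - 1))%Z \/ (2 ^ (prec - 1) < m)%Z by lia.
  have tt_le : t * t <= value y.
    apply: (nearest_ge near_y); last lra.
    rewrite /t /q Em pow2_IZR; last lia.
    by rewrite -!pow2_add; apply: representable_pow2; lia.
  by apply: (rounds_ge rnd_c fin_c rep_t); nra.
set P := (2 ^ (prec - 1))%Z in le_m gt_m.
have PE : (2 ^ prec = 2 * P)%Z.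
  by rewrite -Z.pow_succ_r; [congr (_ ^ _)%Z|]; lia.
have P_gt1 : (1 < P)%Z by apply: Zpow2_gt1; lia.
(* Some multiple of 2^prec 2^(2e) is within half a step of t^2, and it is
   representable. *)
have y_ge : t * t - IZR P * (q * q) <= value y.
  pose k := ((m * m + P) / 2 ^ prec)%Z.
  have := Z.div_mod (m * m + P) (2 ^ prec); have := Z.mod_pos_bound (m * m + P) (2 ^ prec).
  rewrite -/k PE => /(_ _)[|? ?]; first lia; move=> /(_ _) k_div.
  have {}k_div : (m * m + P - 2 * P < 2 * P * k <= m * m + P)%Z by lia.
  have k_ge0 : (0 <= k)%Z by nia.
  have k_le : (k <= 2 ^ prec)%Z by nia.
  pose f := IZR k * pow2 (prec + (e + e)).
  have rep_f : representable f by apply: representable_intro; lia.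
  have fE : f = IZR (2 * P * k) * (q * q).
    rewrite /f (pow2_add prec) (pow2_add e) -/q -(@pow2_IZR prec) ?PE; last lia.
    by rewrite !mult_IZR; ring.
  have qq_gt0 : 0 < q * q by nra.
  have ttE : t * t = IZR (m * m) * (q * q) by rewrite mult_IZR /t; ring.
  have f_ge : t * t - IZR P * (q * q) <= f.
    rewrite ttE fE -Rmult_minus_distr_r -minus_IZR.
    by apply: Rmult_le_compat_r; [lra | apply: IZR_le; lia].
  have f_le : f <= t * t + IZR P * (q * q).
    rewrite ttE fE -Rmult_plus_distr_r -plus_IZR.
    by apply: Rmult_le_compat_r; [lra | apply: IZR_le; lia].
  have [f_le_v|f_gt_v] := Rle_lt_dec f (t * t + 1).
    by have := nearest_ge near_y rep_f f_le_v; lra.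
  case: near_y => _ /(_ _ rep_f); rewrite [Rabs (_ - f)]Rabs_minus_sym.
  rewrite (Rabs_pos_eq (f - _)); last lra.
  by have := Rle_abs (t * t + 1 - value y); lra.
have [//|lt_ct] := Rle_lt_dec t (value c).
have [_ near_c] := rounds_finite rnd_c fin_c.
have c_le := representable_pred (proj1 near_c) gt_m lt_ct.
have sy_mid : sqrt (value y) <= (value c + t) / 2.
  case: near_c => _ /(_ _ rep_t).
  have [//|gt_mid] := Rle_lt_dec (sqrt (value y)) ((value c + t) / 2).
  rewrite Rabs_pos_eq; last lra.
  by case: (Rcase_abs (sqrt (value y) - t)) => ?;
    [rewrite Rabs_left | rewrite Rabs_right]; lra.
have m_ge : IZR P + 1 <= IZR m by rewrite -plus_IZR; apply: IZR_le; lia.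
rewrite minus_IZR -/q in c_le.
have sy_le2 : sqrt (value y) <= (IZR m - 1 / 2) * q by rewrite /t in sy_mid; lra.
have P_gt1R : 1 < IZR P by exact: IZR_lt.
have : value y <= (IZR m - 1 / 2) * q * ((IZR m - 1 / 2) * q) by rewrite -y2; apply: Rmult_le_compat.
have : 0 < q * q by nra.
rewrite /t in y_ge; nra.
Qed.

Definition elt_bounded (B : R) (F : scalars) : elt F -> Prop :=
  match F with
  | RealF => fun x => is_float x /\ Rabs (value x) <= B
  | ComplexF => fun z => (is_float z.1 /\ Rabs (value z.1) <= B) /\
                         (is_float z.2 /\ Rabs (value z.2) <= B)
  end.

Lemma fdiv_float x y : is_finite (fdiv p w x y) -> is_float (fdiv p w x y).
Proof.
case: x => [s1|s1||s1 m1 e1]; case: y => [s2|s2||s2 m2 e2] // fin_q.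
have rnd := @fdiv_rounds (S754_finite s1 m1 e1) (S754_finite s2 m2 e2)
  erefl erefl (@value_finite_neq0 _ _ _).
by case: (rounds_finite rnd fin_q).
Qed.

(** Clamping yields a number in [0, S] whatever [x] is, NaN and infinities
    included; so [rot_tau] is under control without any estimate of the ratio
    that is clamped. *)
Lemma clamp_float x S : (is_finite x -> is_float x) -> is_float S -> 0 <= value S ->
  let t := min_of (fmax x f0) S in is_float t /\ 0 <= value t <= value S.
Proof.
move=> Fx FS S_ge0 /=.
have [->|[F v_ge0]] : fmax x f0 = S754_infinity false \/
    is_float (fmax x f0) /\ 0 <= value (fmax x f0).
  case: x Fx => [s|[]||s m e] Fx; try by [left]; right; try by split=> //=; lra.
  case: s Fx => /(_ erefl) Fx; split=> //; rewrite [fmax _ _]/=; first by rewrite /=; lra.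
  rewrite value_finite; have := pow2_gt0 e; have : 0 < IZR (Zpos m) by exact: IZR_lt.
  nra.
- have -> : min_of (S754_infinity false) S = S by case: S FS {S_ge0}.
  by split=> //; lra.
have [Ft ->] := min_of_float F FS; split=> //.
by split; [apply: Rmin_glb | exact: Rmin_r].
Qed.

(** The tangent is the quotient of tau by a denominator that is at least |tau|,
    by [sqrt_fma_ge]; the cosine is the inverse of a root that is at least
    one. *)
Lemma rot_tan_cos (F : scalars) (A : herm2 F) :
  [/\ is_float (rot_tan p w A), Rabs (value (rot_tan p w A)) <= 1,
      is_float (rot_cos p w A) & Rabs (value (rot_cos p w A)) <= 1].
Proof.
have hprec := prec_ge; have hemax := emax_gt; have [F1 v1] := f1_float.
have [E [emaxE E_gt0 FS [S_ge0 S_le]]] := sqrt_fnu.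
have [Ft le_t] : is_float (rot_tau p w A) /\
    Rabs (value (rot_tau p w A)) <= value (fsqrt p w (fnu p w)).
  rewrite /rot_tau.
  set x := fdiv _ _ _ _; have Fx : is_finite x -> is_float x := @fdiv_float _ _.
  have [Fm [m_ge0 m_le]] := clamp_float Fx FS S_ge0.
  by have [Ft ->] := mul_sign_float (fsub p w (a11 A) (a22 A)) Fm; split=> //; rewrite Rabs_pos_eq.
set t := rot_tau p w A in Ft le_t *.
have t_ge0 := Rabs_pos (value t).
have le_t1 : value t * value t + 1 <= nu.
  have <- : Rabs (value t) * Rabs (value t) = value t * value t.
    by rewrite -Rabs_mult Rabs_pos_eq //; nra.
  by apply: sqr_tau_le emaxE _; split=> //; lra.
have [Fc c_ge1 c_ge_t c_le] := sqrt_fma_ge Ft le_t1.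
have := fadd_rounds F1 Fc; rewrite v1 => rnd_d.
have quarter : 1 <= pow2 (emax - 2).
  by rewrite -pow2_0; apply: pow2_le; lia.
have half : pow2 (emax - 1) = 2 * pow2 (emax - 2).
  have -> : (emax - 1 = 1 + (emax - 2))%Z by lia.
  by rewrite pow2_add (powerRZ_1 2).
have [Fd _] := rounds_le rnd_d (B := pow2 (emax - 1))
  ltac:(rewrite Rabs_pos_eq; lra)
  ltac:(apply: representable_pow2; have := emin_lt0; lia)
  ltac:(apply: pow2_le_nu; lia).
have fin_d := finite_of_float Fd.
have d_ge1 := rounds_ge rnd_d fin_d representable_1 ltac:(lra).
have d_ge_t : Rabs (value t) <= value (fadd p w (f1 p w) (fsqrt p w (fma p w t t (f1 p w)))).
  apply: (rounds_ge rnd_d fin_d); last lra.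
  by have [Fa <-] := SFabs_float Ft; exact: representable_value.
have := @fdiv_rounds t _ (finite_of_float Ft) fin_d ltac:(lra) => rnd_tan.
have [Ftan tan_le] : is_float (rot_tan p w A) /\ Rabs (value (rot_tan p w A)) <= 1.
  apply: (rounds_le rnd_tan _ representable_1 nu_ge1).
  by apply: Rabs_div_le1; lra.
suff [? ?] : is_float (rot_cos p w A) /\ Rabs (value (rot_cos p w A)) <= 1 by [].
  have tan2 : value (rot_tan p w A) * value (rot_tan p w A) + 1 <= nu.
    have := @pow2_le_nu 1; rewrite (powerRZ_1 2) => /(_ _) nu_ge2.
    have : 2 <= nu by apply: nu_ge2; lia.
    have := Rabs_pos (value (rot_tan p w A)).
    by have := Rsqr_abs (value (rot_tan p w A)); rewrite /Rsqr; nra.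
  have [Fc' c'_ge1 _ _] := sqrt_fma_ge Ftan tan2.
  have rnd_cos := @fdiv_rounds _ _ (finite_of_float F1) (finite_of_float Fc') ltac:(lra).
  rewrite v1 in rnd_cos.
  apply: (rounds_le rnd_cos _ representable_1 nu_ge1).
  by apply: Rabs_div_le1; rewrite ?Rabs_R1; lra.
Qed.

(** The computed modulus is the larger component times a root that is at least
    one; the root is at most two, which excludes overflow.  If both components
    vanish, their ratio is NaN and is replaced by zero. *)
Lemma hyp2_ge (z : elt ComplexF) : is_float z.1 -> is_float z.2 ->
    sqrt (value z.1 ^ 2 + value z.2 ^ 2) <= pow2 (emax - 2) ->
  is_float (hyp2 p w z) /\
  Rmax (Rabs (value z.1)) (Rabs (value z.2)) <= value (hyp2 p w z).
Proof.
move=> F1 F2 le_z; have hprec := prec_ge; have hemax := emax_gt.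
have [Fone v1] := f1_float.
have [Fa Ea] := SFabs_float F1; have [Fb Eb] := SFabs_float F2.
have [Fm Em] := min_of_float Fa Fb; have [FM EM] := max_of_float Fa Fb.
rewrite /hyp2; set m := min_of _ _ in Fm Em *; set M := max_of _ _ in FM EM *.
rewrite Ea Eb in Em EM; rewrite -EM.
set a := Rabs (value z.1) in Em EM *; set b := Rabs (value z.2) in Em EM *.
have a_ge0 : 0 <= a := Rabs_pos _; have b_ge0 : 0 <= b := Rabs_pos _.
have m_ge0 : 0 <= value m by rewrite Em; apply: Rmin_glb.
have M_ge0 : 0 <= value M by rewrite EM; apply: Rle_trans (Rmax_l a b).
have le_mM : value m <= value M.
  by rewrite Em EM; apply: Rle_trans (Rmin_l a b) (Rmax_l a b).
have M_le : value M <= pow2 (emax - 2).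
  apply: Rle_trans le_z.
  set L := sqrt _; have L_ge0 : 0 <= L := sqrt_pos _.
  have := proj1 (sqrt_sum_sqr_le (value z.1) (value z.2) L_ge0) (Rle_refl L).
  rewrite -/a -/b => sq.
  by rewrite EM; apply: Rmax_lub; nra.
set q := fmax _ _.
have [Fq [q_ge0 q_le1]] : is_float q /\ 0 <= value q <= 1.
  have [M0|M_neq0] := Req_dec (value M) 0.
    have [s EMz] := value_eq0 FM M0.
    have [s' Emz] := value_eq0 Fm ltac:(lra).
    by rewrite /q EMz Emz /=; split=> //; lra.
  have := fdiv_rounds (finite_of_float Fm) (finite_of_float FM) M_neq0 => rnd_q.
  have [Fd d_le] := rounds_le rnd_q (B := 1)
    ltac:(apply: Rabs_div_le1; rewrite ?Rabs_pos_eq; lra) representable_1 nu_ge1.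
  have d_ge0 := rounds_ge rnd_q (finite_of_float Fd) representable_0
    ltac:(apply: Rle_mult_inv_pos; lra).
  have -> : q = max_of (fdiv p w m M) f0.
    by rewrite /q /fmax; case: (fdiv p w m M) Fd.
  have [Fx ->] := @max_of_float _ f0 Fd erefl; rewrite Rmax_left //=.
  by have := Rle_abs (value (fdiv p w m M)); split=> //; lra.
have nu_ge2 : 2 <= nu.
  by have := @pow2_le_nu 1; rewrite (powerRZ_1 2); apply; lia.
have rep2 : representable 2.
  have := @representable_pow2 1; rewrite (powerRZ_1 2).
  by apply; have := emin_lt0; lia.
have := fma_rounds Fq Fq Fone; rewrite v1 => rnd_y.
have [Fs s_ge1 _ _] := sqrt_fma_ge Fq ltac:(nra).
have [Fy y_le] := rounds_le rnd_y (B := 2) ltac:(rewrite Rabs_pos_eq; nra) rep2 nu_ge2.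
have y_ge0 := rounds_ge rnd_y (finite_of_float Fy) representable_0 ltac:(nra).
have rnd_s := fsqrt_rounds (finite_of_float Fy) y_ge0.
have s_le := rounds_ub rnd_s (finite_of_float Fs) rep2.
set s := fsqrt _ _ _ in Fs s_ge1 rnd_s s_le *.
have {}s_le : value s <= 2.
  apply: s_le; rewrite Rabs_pos_eq // in y_le.
  have := sqrt_sqrt _ y_ge0; have := sqrt_pos (value (fma p w q q (f1 p w))); nra.
have rnd_h := fmul_rounds FM Fs.
have half : pow2 (emax - 1) = 2 * pow2 (emax - 2).
  have -> : (emax - 1 = 1 + (emax - 2))%Z by lia.
  by rewrite pow2_add (powerRZ_1 2).
have [Fh _] := rounds_le rnd_h (B := pow2 (emax - 1))
  ltac:(rewrite Rabs_pos_eq; nra)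
  ltac:(apply: representable_pow2; have := emin_lt0; lia)
  ltac:(apply: pow2_le_nu; lia).
split=> //; apply: (rounds_ge rnd_h (finite_of_float Fh)); last nra.
exact: representable_value.
Qed.

Lemma fmu_float : is_float (fmu p w).
Proof.
have hprec := prec_ge; have hemax := emax_gt.
rewrite /Defs.is_float andbT /= /bounded /canonical_mantissa -[digits2_pos 1]/1%positive.
by apply/andP; split; [apply/Z.eqb_eq | apply/Z.leb_le];
  rewrite /SpecFloat.fexp /SpecFloat.emin; lia.
Qed.

(** A complex entry has each component divided by a number that dominates it.
    If the entry is zero, the cosine is the quotient 0 / 0, and one is taken
    instead. *)
Lemma phase_bounded (F : scalars) (A : herm2 F) : herm2_ok p w A ->
  elt_bounded 1 (elt_phase p w (a21 A)).
Proof.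
have hprec := prec_ge; have hemax := emax_gt; have [Fone v1] := f1_float.
case: F A => A [_ + _ +] /=.
  move=> Fa _; have [Fs ->] := mul_sign_float (a21 A) Fone.
  by rewrite v1 Rabs_R1; split=> //; lra.
move: (a21 A) => z /andP[F1 F2] le_A.
have le_z : sqrt (value z.1 ^ 2 + value z.2 ^ 2) <= pow2 (emax - 2).
  have le_A' := Rle_trans _ _ _ (Rmax_r _ _) le_A.
  have {le_A'}le_A := Rle_trans _ _ _ (Rmax_l _ _) le_A'.
  apply: Rle_trans le_A _.
  have [_ lt_nu] := nu_bounds.
  have -> : pow2 (emax - 2) = pow2 emax / 4.
    by rewrite pow2_sub.
  have : 1 <= sqrt 2 by rewrite -{1}sqrt_1; apply: sqrt_le_1_alt; lra.
  move=> r_ge1; have := nu_ge1 => ?.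
  have E : nu / (4 * sqrt 2) * (4 * sqrt 2) = nu by field; lra.
  by nra.
have [Fh] := hyp2_ge F1 F2 le_z; set h := hyp2 p w z in Fh * => h_ge.
have ge_1 := Rle_trans _ _ _ (Rmax_l _ _) h_ge.
have ge_2 := Rle_trans _ _ _ (Rmax_r _ _) h_ge.
have [Fa Ea] := SFabs_float F1.
have a_ge0 := Rabs_pos (value z.1).
split.
  suff [Fc c_bnd] : is_float (fmin (fdiv p w (SFabs z.1) h) (f1 p w)) /\
      0 <= value (fmin (fdiv p w (SFabs z.1) h) (f1 p w)) <= 1.
    by have [Fs ->] := mul_sign_float z.1 Fc; rewrite Rabs_pos_eq; [split=> //|]; lra.
  have [h0|h_neq0] := Req_dec (value h) 0.
    have -> : fdiv p w (SFabs z.1) h = S754_nan.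
      have [s ->] := value_eq0 Fh h0.
      by have [s' ->] := value_eq0 Fa ltac:(rewrite Ea; lra).
    by rewrite -[fmin _ _]/(f1 p w) v1; split=> //; lra.
  have := fdiv_rounds (finite_of_float Fa) (finite_of_float Fh) h_neq0; rewrite Ea => rnd_c.
  have [Fd d_le] := rounds_le rnd_c (B := 1)
    ltac:(apply: Rabs_div_le1; rewrite ?Rabs_Rabsolu; lra) representable_1 nu_ge1.
  have d_ge0 := rounds_ge rnd_c (finite_of_float Fd) representable_0
    ltac:(apply: Rle_mult_inv_pos; lra).
  have -> : fmin (fdiv p w (SFabs z.1) h) (f1 p w) = min_of (fdiv p w (SFabs z.1) h) (f1 p w).
    by rewrite /fmin; case: (fdiv p w (SFabs z.1) h) Fd.
  have [Fx ->] := min_of_float Fd Fone; split=> //; rewrite v1.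
  by split; [apply: Rmin_glb; lra | exact: Rmin_r].
have [Fx Ex] := max_of_float Fh fmu_float.
have mu_gt0 : 0 < value (fmu p w).
  rewrite /fmu value_finite; have := pow2_gt0 emin; lra.
have max_h := Rmax_l (value h) (value (fmu p w)).
have max_mu := Rmax_r (value h) (value (fmu p w)).
have rnd_s := fdiv_rounds (finite_of_float F2) (finite_of_float Fx) ltac:(rewrite Ex; lra).
apply: (rounds_le rnd_s _ representable_1 nu_ge1).
by rewrite Ex; apply: Rabs_div_le1; lra.
Qed.

(** * The transformed elements *)

Lemma fmul_bounded x c B : is_float x -> Rabs (value x) <= B -> is_float c ->
    Rabs (value c) <= 1 -> representable B -> B <= nu ->
  is_float (fmul p w x c) /\ Rabs (value (fmul p w x c)) <= B.
Proof.
move=> Fx le_x Fc le_c rep_B le_B.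
apply: (rounds_le (fmul_rounds Fx Fc)) => //; rewrite Rabs_mult.
have := Rabs_pos (value x); have := Rabs_pos (value c); nra.
Qed.

Lemma scale_bounded (F : scalars) (z : elt F) c B : elt_bounded B z ->
    is_float c -> Rabs (value c) <= 1 -> representable B -> B <= nu ->
  elt_bounded B (elt_scale p w z c).
Proof.
case: F z => z /=; first by case=> ? ? ? ? ? ?; exact: fmul_bounded.
by case=> [[? ?] [? ?]] ? ? ? ?; split; exact: fmul_bounded.
Qed.

Lemma oppconj_bounded (F : scalars) (z : elt F) B :
  elt_bounded B z -> elt_bounded B (elt_oppconj z).
Proof.
case: F z => z /=.
  by case=> Fz le_z; have [? ->] := SFopp_float Fz; rewrite Rabs_Ropp.
by case=> [[Fz le_z] ?]; have [? ->] := SFopp_float Fz; rewrite Rabs_Ropp.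
Qed.

Lemma fma_bounded x e c X C B : is_float x -> is_float e -> is_float c ->
    Rabs (value e) <= 1 -> Rabs (value x) <= X -> Rabs (value c) <= C ->
    X + C <= B -> representable B -> B <= nu ->
  is_float (fma p w x e c) /\ Rabs (value (fma p w x e c)) <= B.
Proof.
move=> Fx Fe Fc le_e le_x le_c le_XC rep_B le_B.
apply: (rounds_le (fma_rounds Fx Fe Fc)) => //.
apply: Rle_trans (Rabs_triang _ _) _; rewrite Rabs_mult.
have := Rabs_pos (value x); have := Rabs_pos (value e); nra.
Qed.

(** With N = 2^(emax-2), the exact value is at most |x| + |y| + N, hence at most
    (1 + sqrt 2) N.  To carry this through two roundings without error terms,
    [y] is compared with 3/4 N: if it is smaller, the bounds are 7/4 N and then
    11/4 N; if it is larger, then |x| <= 3/4 N, and the bounds are 2 N and then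
    11/4 N.  All of them are representable. *)
Lemma fma2_bounded x y e1 e2 c :
    is_float x -> is_float y -> is_float e1 -> is_float e2 -> is_float c ->
    Rabs (value e1) <= 1 -> Rabs (value e2) <= 1 ->
    sqrt (value x ^ 2 + value y ^ 2) <= pow2 (emax - 2) ->
    Rabs (value c) <= pow2 (emax - 2) ->
  is_float (fma p w x e1 (fma p w y e2 c)) /\
  Rabs (value (fma p w x e1 (fma p w y e2 c))) <= 11 * pow2 (emax - 4).
Proof.
move=> Fx Fy F1 F2 Fc le_1 le_2 le_xy le_c.
have hprec := prec_ge; have hemax := emax_gt; have [nu_ge _] := nu_bounds.
have p16 : (16 <= 2 ^ prec)%Z.
  by have : (2 ^ 4 <= 2 ^ prec)%Z by [apply: Z.pow_le_mono_r; lia]; lia.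
have rep k : (0 <= k <= 16)%Z -> representable (IZR k * pow2 (emax - 4)).
  by move=> ?; apply: representable_intro; rewrite /SpecFloat.emin; lia.
have a_ge0 := Rabs_pos (value x); have b_ge0 := Rabs_pos (value y).
have sq : Rabs (value x) * Rabs (value x) + Rabs (value y) * Rabs (value y)
    <= pow2 (emax - 2) * pow2 (emax - 2).
  by apply/sqrt_sum_sqr_le => //; have := pow2_gt0 (emax - 2); lra.
have N_gt0 := pow2_gt0 emax.
rewrite !pow2_sub // in le_c sq rep *; rewrite /= in le_c sq rep *.
set N := pow2 emax in nu_ge N_gt0 le_c sq rep *.
have [le_y|gt_y] := Rle_lt_dec (Rabs (value y)) (3 / 16 * N).
  have [Fi le_i] := fma_bounded Fy F2 Fc le_2 le_y le_c (B := 7 * (N / 16))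
    ltac:(lra) ltac:(apply: rep; lia) ltac:(lra).
  have le_x : Rabs (value x) <= N / 4 by nra.
  apply: (fma_bounded Fx F1 Fi le_1 le_x le_i); try lra.
  by apply: rep; lia.
have le_y : Rabs (value y) <= N / 4 by nra.
have [Fi le_i] := fma_bounded Fy F2 Fc le_2 le_y le_c (B := 8 * (N / 16))
  ltac:(lra) ltac:(apply: rep; lia) ltac:(lra).
have le_x : Rabs (value x) <= 3 / 16 * N by nra.
apply: (fma_bounded Fx F1 Fi le_1 le_x le_i); try lra.
by apply: rep; lia.
Qed.

(** In the complex case, 11/16 2^emax lies between the bound
    (1 + sqrt 2) / 4 2^emax on the exact components and [nu] / sqrt 2, the
    largest bound on the components that keeps the modulus below [nu]. *)
Definition comp_bound (F : scalars) : R :=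
  match F with RealF => nu | ComplexF => 11 * pow2 (emax - 4) end.

Lemma comp_boundP (F : scalars) : representable (comp_bound F) /\ comp_bound F <= nu.
Proof.
have hprec := prec_ge; have hemax := emax_gt; have [nu_ge _] := nu_bounds.
case: F => /=; first by split; [exact: representable_nu | lra].
split.
  apply: representable_intro; last by rewrite /SpecFloat.emin; lia.
  by have : (2 ^ 4 <= 2 ^ prec)%Z by [apply: Z.pow_le_mono_r; lia]; lia.
rewrite pow2_sub //=.
by have := pow2_gt0 emax; lra.
Qed.

Lemma elt_bounded_modulus (F : scalars) (z : elt F) : elt_bounded (comp_bound F) z ->
  elt_all is_finite z /\ modulus z <= nu.
Proof.
have hprec := prec_ge; have hemax := emax_gt; have [nu_ge _] := nu_bounds.
case: F z => z /=; first by case=> /finite_of_float.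
move=> [[/finite_of_float-> le_1] [/finite_of_float-> le_2]]; split=> //.
apply/sqrt_sum_sqr_le; first by have := nu_ge1; lra.
move: le_1 le_2; rewrite pow2_sub //=.
have := Rabs_pos (value z.1); have := Rabs_pos (value z.2).
by have := pow2_gt0 emax; nra.
Qed.

Lemma elt_fma_bounded (F : scalars) (a e c : elt F) :
    elt_all is_float a -> elt_all is_float c -> elt_bounded 1 e ->
    modulus a <= nu / varsigma F -> modulus c <= nu / varsigma F ->
  elt_bounded (comp_bound F) (elt_fma p w a e c).
Proof.
have hprec := prec_ge; have hemax := emax_gt; have [_ nu_lt] := nu_bounds.
case: F a e c => a e c /=.
  move=> Fa Fc [Fe le_e] le_a le_c.
  apply: (fma_bounded Fa Fe Fc le_e le_a le_c); try lra.
  exact: representable_nu.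
move=> /andP[Fa1 Fa2] /andP[Fc1 Fc2] [[Fe1 le_e1] [Fe2 le_e2]] le_a le_c.
have N_E : pow2 (emax - 2) = pow2 emax / 4.
  by rewrite pow2_sub.
have le_comp x y : sqrt (x ^ 2 + y ^ 2) <= nu / 4 ->
    Rabs x <= pow2 (emax - 2) /\ Rabs y <= pow2 (emax - 2).
  move=> le_xy; rewrite N_E.
  have := nu_ge1 => ?; have /sqrt_sum_sqr_le-/(_ ltac:(lra)) := le_xy.
  by have := Rabs_pos x; have := Rabs_pos y; split; nra.
have [le_c1 le_c2] := le_comp _ _ le_c.
have [Fo Eo] := SFopp_float Fa2.
have {}le_a : sqrt (value a.1 ^ 2 + value a.2 ^ 2) <= pow2 (emax - 2).
  by rewrite N_E; apply: Rle_trans le_a _; lra.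
split; apply: fma2_bounded => //.
by rewrite Eo; have -> : (- value a.2) ^ 2 = value a.2 ^ 2 by ring.
Qed.

Lemma rotate_bounded (F : scalars) (A : herm2 F) (x y : elt F) :
    herm2_ok p w A -> elt_all is_float x -> elt_all is_float y ->
    modulus x <= nu / varsigma F -> modulus y <= nu / varsigma F ->
  elt_bounded (comp_bound F) (rotate p w A x y).1 /\
  elt_bounded (comp_bound F) (rotate p w A x y).2.
Proof.
move=> okA Fx Fy le_x le_y; have [Ft le_t Fc le_c] := rot_tan_cos A.
have [rep_B le_B] := comp_boundP F.
have bnd_e : elt_bounded 1 (rot_e p w A).
  apply: scale_bounded => //; [exact: phase_bounded | exact: representable_1 | exact: nu_ge1].
split; apply: scale_bounded => //; apply: elt_fma_bounded => //.
exact: oppconj_bounded.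
Qed.

End Format.

(** * The step *)

Lemma modulus_le_max_norm F m n (G : 'M[elt F]_(m, n)) i j :
  modulus (G i j) <= max_norm G.
Proof.
have le_big (I : finType) (f : I -> R) i0 : f i0 <= \big[Rmax/0]_i f i.
  have : i0 \in index_enum I by exact: mem_index_enum.
  elim: (index_enum I) => // k s IH; rewrite inE big_cons => /orP[/eqP->|/IH].
    exact: Rmax_l.
  by move=> le_f; apply: Rle_trans le_f (Rmax_r _ _).
apply: Rle_trans (le_big _ (fun i => \big[Rmax/0]_(j < n) modulus (G i j)) i).
exact: (le_big _ (fun j => modulus (G i j))).
Qed.

Lemma max_norm_le F m n (G : 'M[elt F]_(m, n)) B : 0 <= B ->
  (forall i j, modulus (G i j) <= B) -> max_norm G <= B.
Proof.
move=> B_ge0 le_G.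
have max_le x y : x <= B -> y <= B -> Rmax x y <= B by exact: Rmax_lub.
apply: (big_ind (fun x => x <= B)) => // i _.
exact: (big_ind (fun x => x <= B)).
Qed.

Theorem proposition3p3 (p w : Z) (hp : (23 <= p)%Z)
    (hw : (p + 1 < 2 ^ (w - 1))%Z)
    (F : scalars) (m n : nat) (G : 'M[elt F]_(m, n)) (s : jacobi_step F n)
    (hs : step_ok p w s)
    (hG : mx_all (is_float p w) G)
    (hnorm : (max_norm G <= nu p w / varsigma F)%R) :
  mx_all is_finite (next_iterate p w s G) /\
  (max_norm (next_iterate p w s G) <= nu p w)%R.
Proof.
have nu1 := nu_ge1 hp hw.
have le_G i j : modulus (G i j) <= nu p w / varsigma F.
  exact: Rle_trans (modulus_le_max_norm G i j) hnorm.
have keep i j : elt_all is_finite (G i j) /\ modulus (G i j) <= nu p w.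
  split; last by apply: Rle_trans (le_G i j) _; case: (F) => /=; lra.
  have := hG i j; case: (F) (G i j) => z /=; first exact: finite_of_float.
  by case/andP=> /finite_of_float-> /finite_of_float.
suff bnd i j : elt_all is_finite (next_iterate p w s G i j) /\
    modulus (next_iterate p w s G i j) <= nu p w.
  split=> [i j|]; first by case: (bnd i j).
  by apply: max_norm_le => [|i j]; [lra | case: (bnd i j)].
rewrite mxE; case: pickP => [pq /andP[pq_in _]|_]; last exact: keep.
have [_ _ okA] := hs.
suff [bnd1 bnd2] :
    (elt_all is_finite (transform_pair p w s pq (G i pq.1) (G i pq.2)).1 /\
     modulus (transform_pair p w s pq (G i pq.1) (G i pq.2)).1 <= nu p w) /\
    (elt_all is_finite (transform_pair p w s pq (G i pq.1) (G i pq.2)).2 /\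
     modulus (transform_pair p w s pq (G i pq.1) (G i pq.2)).2 <= nu p w).
  by case: (j == pq.1).
rewrite /transform_pair; case rotE: (Defs.rot s pq) => [A|]; last first.
  by case: (swap s pq); split; exact: keep.
have [/(elt_bounded_modulus hp hw) bnd1 /(elt_bounded_modulus hp hw) bnd2] :=
  rotate_bounded hp hw (okA _ _ pq_in rotE) (hG i pq.1) (hG i pq.2)
    (le_G i pq.1) (le_G i pq.2).
by case: (swap s pq).
Qed.
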